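(* Let $\alpha\ge 1$ and let $\boldsymbol{\gamma}=(\gamma_j)_{j\ge1}$ be a sequence of weights with $1\ge\gamma_1\ge\gamma_2\ge\cdots>0$. Put $\boldsymbol{\gamma}_I:=\inf_{j\ge1}\gamma_j$ and $s_{\boldsymbol{\gamma}}:=\inf\{\kappa>0:\sum_{j=1}^\infty\gamma_j^\kappa<\infty\}$ (with $\inf\emptyset:=\infty$). Consider the $L_2$-approximation problem $\mathrm{APP}=(\mathrm{APP}_s)_{s\ge1}$ for the weighted Hermite spaces $\mathcal{H}_{r_{s,\alpha,\boldsymbol{\gamma}}}$, $s\in\mathbb{N}$, and for the information class $\Lambda^{\mathrm{all}}$. Then: 1. SPT holds if and only if $s_{\boldsymbol{\gamma}}<\infty$. In this case the exponent of SPT is $\tau^*(\Lambda^{\mathrm{all}})=2\max\left(\frac1\alpha,s_{\boldsymbol{\gamma}}\right)$. 2. SPT and PT are equivalent. 3. QPT, UWT and WT are equivalent and hold if and only if $\boldsymbol{\gamma}_I<1$. In this case the exponent of QPT is $$t^*(\Lambda^{\mathrm{all}})=\begin{cases}2\max\left(\frac1\alpha,\frac{1}{\ln\boldsymbol{\gamma}_I^{-1}}\right)&\text{if }\boldsymbol{\gamma}_I\neq0,\\ \frac{2}{\alpha}&\text{if }\boldsymbol{\gamma}_I=0.\end{cases}$$ 4. For $\sigma>1$ (and every $\tau>0$), $(\sigma,\tau)$-WT holds for all weights $1\ge\gamma_1\ge\gamma_2\ge\cdots>0$.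
   Context: Hermite polynomials: for $k\in\mathbb{N}_0$, $H_k(x)=\frac{(-1)^k}{\sqrt{k!}}e^{x^2/2}\frac{d^k}{dx^k}e^{-x^2/2}$; for $\boldsymbol{k}\in\mathbb{N}_0^s$, $H_{\boldsymbol{k}}(\boldsymbol{x})=\prod_{j=1}^sH_{k_j}(x_j)$. Let $\varphi(x)=\frac1{\sqrt{2\pi}}e^{-x^2/2}$, $\varphi_s(\boldsymbol{x})=\prod_{j=1}^s\varphi(x_j)$. The $H_{\boldsymbol{k}}$ form an orthonormal basis of $L_2(\mathbb{R}^s,\varphi_s)$ (all functions real-valued); $\widehat f(\boldsymbol{k})=\int_{\mathbb{R}^s}fH_{\boldsymbol{k}}\varphi_s\,d\boldsymbol{x}$. Fourier weights: for $\gamma\in(0,1]$, $r_{\alpha,\gamma}(0)=1$, $r_{\alpha,\gamma}(k)=\gamma\frac1{k!}$ for $1\le k<\alpha$, and $r_{\alpha,\gamma}(k)=\gamma\frac{(k-\alpha)!}{k!}$ for $k\ge\alpha$, where $(k-\alpha)!$ means $\Gamma(k-\alpha+1)$ if $\alpha$ is not an integer. Let $r_{s,\alpha,\boldsymbol{\gamma}}(\boldsymbol{k})=\prod_{j=1}^sr_{\alpha,\gamma_j}(k_j)$. The space $\mathcal{H}_{r_{s,\alpha,\boldsymbol{\gamma}}}$ is the reproducing kernel Hilbert space on $\mathbb{R}^s$ with kernel $K(\boldsymbol{x},\boldsymbol{y})=\sum_{\boldsymbol{k}\in\mathbb{N}_0^s}r_{s,\alpha,\boldsymbol{\gamma}}(\boldsymbol{k})H_{\boldsymbol{k}}(\boldsymbol{x})H_{\boldsymbol{k}}(\boldsymbol{y})$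 (an absolutely convergent series) and inner product $\langle f,g\rangle=\sum_{\boldsymbol{k}}\frac{1}{r_{s,\alpha,\boldsymbol{\gamma}}(\boldsymbol{k})}\widehat f(\boldsymbol{k})\widehat g(\boldsymbol{k})$; it consists of the functions $f=\sum_{\boldsymbol{k}}\widehat f(\boldsymbol{k})H_{\boldsymbol{k}}$ (pointwise) of finite norm. Approximation: $\mathrm{APP}_s:\mathcal{H}_{r_{s,\alpha,\boldsymbol{\gamma}}}\to L_2(\mathbb{R}^s,\varphi_s)$, $\mathrm{APP}_s(f)=f$. Algorithms have the form $A_n(f)=\sum_{i=1}^nL_i(f)g_i$ with $g_i\in L_2(\mathbb{R}^s,\varphi_s)$ and $L_i\in\Lambda^{\mathrm{all}}$, the class of all continuous linear functionals on $\mathcal{H}_{r_{s,\alpha,\boldsymbol{\gamma}}}$. The worst-case error of $A_n$ is $\sup_{\|f\|\le1}\|f-A_n(f)\|_{L_2(\mathbb{R}^s,\varphi_s)}$, $e(n,\mathrm{APP}_s;\Lambda^{\mathrm{all}})$ is the infimum of these errors over all such $A_n$ (for $n=0$ only the zero algorithm, with error $1$), and $n(\varepsilon,s):=n(\varepsilon,\mathrm{APP}_s;\Lambda^{\mathrm{all}})=\min\{n\in\mathbb{N}_0:e(n,\mathrm{APP}_s;\Lambda^{\mathrm{all}})\le\varepsilon\}$ for $\varepsilon\in(0,1)$, $s\in\mathbb{N}$. Tractability notions ($\log=\ln$ natural logarithm): PT: there are $\tau,\sigma,C\ge0$ with $n(\varepsilon,s)\le C\varepsilon^{-\tau}s^\sigma$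 for all $s\in\mathbb{N},\varepsilon\in(0,1)$. SPT: there are $\tau,C\ge0$ with $n(\varepsilon,s)\le C\varepsilon^{-\tau}$ for all $s\in\mathbb{N},\varepsilon\in(0,1)$; the exponent of SPT is the infimum of all $\tau$ for which such a $C>0$ exists. QPT: there are $\tau,C\ge0$ with $n(\varepsilon,s)\le C\exp(\tau(1+\log s)(1+\log\varepsilon^{-1}))$ for all $s\in\mathbb{N},\varepsilon\in(0,1)$; the exponent of QPT is the infimum of all $\tau$ for which such a $C>0$ exists. $(\sigma,\tau)$-WT (for given $\sigma,\tau>0$): $\lim_{s+\varepsilon^{-1}\to\infty}\frac{\log n(\varepsilon,s)}{s^\sigma+\varepsilon^{-\tau}}=0$. WT: $(1,1)$-WT. UWT: $(\sigma,\tau)$-WT for all $\sigma,\tau\in(0,1]$. *)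

(* Defs.v *)
From HB Require Import structures.
From mathcomp Require Import all_boot all_order all_algebra.
From mathcomp Require Import finmap.
From mathcomp Require Import all_classical all_reals all_analysis.
From mathcomp Require showcase.summability.

Set Implicit Arguments.
Unset Strict Implicit.
Unset Printing Implicit Defensive.

Import Order.TTheory GRing.Theory Num.Theory.
Import numFieldNormedType.Exports.

Local Open Scope classical_set_scope.
Local Open Scope ring_scope.

(* R^s with its Borel sigma-algebra; L2 is unchanged, up to equality almost
   everywhere, by using Borel instead of Lebesgue measurable functions. *)
Notation Rn R s := (s.-tuple (measurableTypeR R)).

Definition cons_pair (R : realType) (s : nat)
    (p : measurableTypeR R * Rn R s) : Rn R s.+1 :=
  [tuple of p.1 :: p.2].

Lemma measurable_cons_pair (R : realType) (s : nat) :
  measurable_fun setT (@cons_pair R s).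
Proof. exact: measurable_cons. Qed.

(* Product of the Lebesgue measure on R with a measure on R^s, transported to
   R^(s+1) along (a, x) |-> (a, x_0, ..., x_(s-1)). *)
Section lebesgue_cons.
Context (R : realType) (s : nat).
Context (m : {sigma_finite_measure set (Rn R s) -> \bar R}).
Local Open Scope ereal_scope.

Definition lebesgue_cons : set (Rn R s.+1) -> \bar R :=
  pushforward ((@lebesgue_measure R) \x m) (@cons_pair R s).

Let preimage_cons A : measurable A -> measurable (@cons_pair R s @^-1` A).
Proof.
by move=> mA; rewrite -[X in measurable X]setTI; exact: measurable_cons_pair.
Qed.

Let lebesgue_cons0 : lebesgue_cons set0 = 0.
Proof. by rewrite /lebesgue_cons /pushforward preimage_set0 measure0. Qed.

Let lebesgue_cons_ge0 A : 0 <= lebesgue_cons A.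
Proof. exact: (measure_ge0 ((@lebesgue_measure R) \x m)). Qed.

Let lebesgue_cons_sigma_additive : semi_sigma_additive lebesgue_cons.
Proof.
move=> F mF tF mUF; rewrite /lebesgue_cons /pushforward preimage_bigcup.
apply: (@measure_semi_sigma_additive _ _ _ ((@lebesgue_measure R) \x m)).
- by move=> n; exact: preimage_cons.
- apply/trivIsetP => /= i j _ _ ij; rewrite -preimage_setI.
  by move/trivIsetP : tF => /(_ _ _ _ _ ij) ->//; rewrite preimage_set0.
- by rewrite -preimage_bigcup; exact: preimage_cons.
Qed.

HB.instance Definition _ := isMeasure.Build _ _ _ lebesgue_cons
  lebesgue_cons0 lebesgue_cons_ge0 lebesgue_cons_sigma_additive.

Let lebesgue_cons_sigma_finite : sigma_finite setT lebesgue_cons.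
Proof.
have /sigma_finiteP[F [TF ndF Foo]] := sigma_finiteT (@lebesgue_measure R).
have /sigma_finiteP[G [TG ndG Goo]] := sigma_finiteT m.
pose unc (x : Rn R s.+1) : measurableTypeR R * Rn R s :=
  (tnth x ord0, [tuple of behead x]).
have unc_cons p : unc (cons_pair p) = p.
  by case: p => a b; rewrite /unc/=; congr pair; apply: val_inj.
have munc : measurable_fun setT unc.
  by apply/measurable_fun_pairP; split;
    [exact: measurable_tnth|exact: measurable_behead].
exists (fun n => unc @^-1` (F n `*` G n)) => [|n].
  rewrite -preimage_bigcup predeqE => x; split=> // _.
  have [i _ Fi] : (\bigcup_i F i) (unc x).1 by rewrite -TF.
  have [j _ Gj] : (\bigcup_i G i) (unc x).2 by rewrite -TG.
  exists (maxn i j) => //; split.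
  - by move: Fi; exact/subsetPset/ndF/leq_maxl.
  - by move: Gj; exact/subsetPset/ndG/leq_maxr.
have [mF Fnoo] := Foo n; have [mG Gnoo] := Goo n; split.
  by rewrite -[X in measurable X]setTI; apply: munc => //; exact: measurableX.
have -> : lebesgue_cons (unc @^-1` (F n `*` G n)) =
    ((@lebesgue_measure R) \x m) (F n `*` G n).
  congr (product_measure1 _ _ _); rewrite predeqE => p.
  change ((F n `*` G n) (unc (cons_pair p)) <-> (F n `*` G n) p).
  by rewrite unc_cons.
by rewrite product_measure1E// lte_mul_pinfty// ge0_fin_numE.
Qed.

HB.instance Definition _ := Measure_isSigmaFinite.Build _ _ _ lebesgue_cons
  lebesgue_cons_sigma_finite.

End lebesgue_cons.

Fixpoint lebesgue_Rn (R : realType) (s : nat) :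
    {sigma_finite_measure set (Rn R s) -> \bar R} :=
  match s with
  | 0 => dirac ([tuple] : Rn R 0)
  | s'.+1 => lebesgue_cons (lebesgue_Rn R s')
  end.

Definition hermite (R : realType) (k : nat) (x : R) : R :=
  (-1) ^+ k / Num.sqrt (k`!%:R) * expR (x ^+ 2 / 2)
  * derive1n k (fun y : R => expR (- (y ^+ 2 / 2))) x.

Definition Hermite (R : realType) (s : nat) (k : s.-tuple nat) (x : Rn R s) : R :=
  \prod_(j < s) hermite (tnth k j) (tnth x j).

Definition phi (R : realType) (x : R) : R :=
  (Num.sqrt (2 * pi))^-1 * expR (- (x ^+ 2 / 2)).

Definition phis (R : realType) (s : nat) (x : Rn R s) : R :=
  \prod_(j < s) phi (tnth x j).

(* The norm of L_2(R^s, phi_s), weight phi_s with respect to Lebesgue measure. *)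
Definition L2norm (R : realType) (s : nat) (f : Rn R s -> R) : \bar R :=
  ((\int[lebesgue_Rn R s]_x (f x ^+ 2 * phis x)%:E) `^ (2^-1))%E.

Definition L2 (R : realType) (s : nat) : set (Rn R s -> R) :=
  [set f | measurable_fun setT f /\ (L2norm f < +oo)%E].

Definition fhat (R : realType) (s : nat) (f : Rn R s -> R) (k : s.-tuple nat) : R :=
  \int[lebesgue_Rn R s]_x (f x * Hermite k x * phis x).

(* Euler's integral, which is finite for x > 0; it is only used for x >= 1. *)
Definition Gamma (R : realType) (x : R) : R :=
  \int[lebesgue_measure]_(t in `]0, +oo[) (t `^ (x - 1) * expR (- t)).

(* x! for real x >= 0. *)
Definition rfact (R : realType) (x : R) : R :=
  if x \is a Num.nat then (Num.truncn x)`!%:R else Gamma (x + 1).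

Definition fweight (R : realType) (alpha gamma : R) (k : nat) : R :=
  if k == 0%N then 1
  else if k%:R < alpha then gamma * (1 / k`!%:R)
  else gamma * (rfact (k%:R - alpha) / k`!%:R).

(* In dimension s the weights in use are gamma 0, ..., gamma (s - 1), that is,
   the sequence (gamma_j)_(j >= 1) is shifted to start at index 0. *)
Definition fweights (R : realType) (alpha : R) (gamma : nat -> R) (s : nat)
    (k : s.-tuple nat) : R :=
  \prod_(j < s) fweight alpha (gamma j) (tnth k j).

Definition Hnorm (R : realType) (alpha : R) (gamma : nat -> R) (s : nat)
    (f : Rn R s -> R) : \bar R :=
  ((\esum_(k in [set: s.-tuple nat])
     ((fweights alpha gamma k)^-1 * fhat f k ^+ 2)%:E) `^ (2^-1))%E.

(* The pointwise Hermite expansion over the multi-indices is understood as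
   unconditional (equivalently, absolute) convergence: limit of the partial
   sums along the finite sets of multi-indices directed by inclusion. *)
Definition Hspace (R : realType) (alpha : R) (gamma : nat -> R) (s : nat) :
    set (Rn R s -> R) :=
  [set f | [/\ L2 f, (Hnorm alpha gamma f < +oo)%E &
    forall x, summability.partial_sum (fun k : s.-tuple nat => fhat f k * Hermite k x)
      @ summability.totally --> f x]].

(* A functional on the space is given by a function on all of R^s -> R whose
   values outside the space are irrelevant. *)
Definition Lambda_all (R : realType) (alpha : R) (gamma : nat -> R) (s : nat) :
    set ((Rn R s -> R) -> R) :=
  [set L | (forall (a : R) f g,
        Hspace alpha gamma f -> Hspace alpha gamma g ->
        L (fun x => a * f x + g x) = a * L f + L g) /\
     (forall f, Hspace alpha gamma f -> forall e : R, 0 < e ->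
        exists2 d : R, 0 < d & forall g, Hspace alpha gamma g ->
          (Hnorm alpha gamma (fun x => (g x - f x)%R) < d%:E)%E ->
          `|L g - L f| < e)].

Definition algorithm (R : realType) (s n : nat)
    (L : 'I_n -> (Rn R s -> R) -> R) (g : 'I_n -> Rn R s -> R)
    (f : Rn R s -> R) : Rn R s -> R :=
  fun x => \sum_(i < n) L i f * g i x.

Definition wc_error (R : realType) (alpha : R) (gamma : nat -> R) (s : nat)
    (A : (Rn R s -> R) -> Rn R s -> R) : \bar R :=
  ereal_sup [set L2norm (fun x => f x - A f x) |
    f in [set f | Hspace alpha gamma f /\ (Hnorm alpha gamma f <= 1)%E]].

Definition min_error (R : realType) (alpha : R) (gamma : nat -> R) (n s : nat) :
    \bar R :=
  ereal_inf [set e | exists (L : 'I_n -> (Rn R s -> R) -> R)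
      (g : 'I_n -> Rn R s -> R),
    [/\ forall i, Lambda_all alpha gamma (L i), forall i, L2 (g i) &
        e = wc_error alpha gamma (algorithm L g)]].

(* The minimum of a set of natural numbers, +oo if the set is empty. *)
Definition info_complexity (R : realType) (alpha : R) (gamma : nat -> R)
    (eps : R) (s : nat) : \bar R :=
  ereal_inf [set n%:R%:E | n in
    [set n : nat | (min_error alpha gamma n s <= eps%:E)%E]].

Definition PT (R : realType) (n : R -> nat -> \bar R) : Prop :=
  exists tau sigma C : R, [/\ 0 <= tau, 0 <= sigma, 0 <= C &
    forall (s : nat) (eps : R), (0 < s)%N -> 0 < eps < 1 ->
      (n eps s <= (C * eps `^ (- tau) * s%:R `^ sigma)%:E)%E].

Definition SPT_bound (R : realType) (n : R -> nat -> \bar R) (tau C : R) : Prop :=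
  forall (s : nat) (eps : R), (0 < s)%N -> 0 < eps < 1 ->
    (n eps s <= (C * eps `^ (- tau))%:E)%E.

Definition SPT (R : realType) (n : R -> nat -> \bar R) : Prop :=
  exists tau C : R, [/\ 0 <= tau, 0 <= C & SPT_bound n tau C].

Definition SPT_exponent (R : realType) (n : R -> nat -> \bar R) : \bar R :=
  ereal_inf [set tau%:E | tau in
    [set tau : R | 0 <= tau /\ exists2 C, 0 < C & SPT_bound n tau C]].

Definition QPT_bound (R : realType) (n : R -> nat -> \bar R) (tau C : R) : Prop :=
  forall (s : nat) (eps : R), (0 < s)%N -> 0 < eps < 1 ->
    (n eps s <= (C * expR (tau * (1 + ln s%:R) * (1 + ln eps^-1)))%:E)%E.

Definition QPT (R : realType) (n : R -> nat -> \bar R) : Prop :=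
  exists tau C : R, [/\ 0 <= tau, 0 <= C & QPT_bound n tau C].

Definition QPT_exponent (R : realType) (n : R -> nat -> \bar R) : \bar R :=
  ereal_inf [set tau%:E | tau in
    [set tau : R | 0 <= tau /\ exists2 C, 0 < C & QPT_bound n tau C]].

(* The limit as s + 1/eps tends to infinity. *)
Definition WTst (R : realType) (n : R -> nat -> \bar R) (sigma tau : R) : Prop :=
  forall e : R, 0 < e -> exists M : R,
    forall (s : nat) (eps : R), (0 < s)%N -> 0 < eps < 1 -> M <= s%:R + eps^-1 ->
      (`| lne (n eps s) * ((s%:R `^ sigma + eps `^ (- tau))^-1)%:E | < e%:E)%E.

Definition WT (R : realType) (n : R -> nat -> \bar R) : Prop := WTst n 1 1.

Definition UWT (R : realType) (n : R -> nat -> \bar R) : Prop :=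
  forall sigma tau : R, 0 < sigma <= 1 -> 0 < tau <= 1 -> WTst n sigma tau.

Definition sum_exponent (R : realType) (gamma : nat -> R) : \bar R :=
  ereal_inf [set kappa%:E | kappa in [set kappa : R | 0 < kappa /\
    (\sum_(0 <= j <oo) (gamma j `^ kappa)%:E < +oo)%E]].

(* Main.v *)
Require Import Defs.
From mathcomp Require Import all_boot all_order all_algebra.
From mathcomp Require Import finmap.
From mathcomp Require Import all_classical all_reals all_analysis.
From mathcomp Require Import measurable_realfun ring lra.
From mathcomp Require showcase.summability.

(* The eigenvalues of the squared embedding are the Fourier weights r(k), so
   n(eps, s) is the number of multi-indices k with r(k) > eps^2.  Truncating the
   Hermite series to these k has error at most eps; conversely n functionals
   vanish simultaneously on some nonzero f in the span of any n + 1 of the H_k.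

   Upper bounds on this count come from Chebyshev's inequality
   n(eps, s) <= eps^(-2p) sum_k r(k)^p = eps^(-2p) prod_j (1 + gamma_j^p S_p),
   where S_p is finite iff p > 1/alpha since r(k)/gamma decays like k^(-alpha);
   p is constant for SPT and proportional to 1 + ln s for QPT.  Lower bounds
   come from s = 1 and from multi-indices with entries in {0, 1}, of which
   those with m ones have weight at least gamma_s^m. *)

Set Implicit Arguments.
Unset Strict Implicit.
Unset Printing Implicit Defensive.

Import Order.TTheory GRing.Theory Num.Theory.
Import numFieldNormedType.Exports.

Local Open Scope classical_set_scope.
Local Open Scope ring_scope.

Local Notation mu := lebesgue_measure.

(** * Hermite polynomials in one variable *)

(** The count involves the strict inequality r(k) > eps^2, so the test accuracies in the lower
    bounds are taken with eps^2 strictly below the weights in play, usually by a factor 1/2. With m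
    ones among s entries there are about s^m multi-indices. Against a bound of degree sigma in s,
    any fixed m > sigma forces gamma_s to decay like a power of s, which is why PT already gives
    SPT; m = 1 yields the sharp exponent. For QPT, eps depends only on m, s tends to infinity first,
    and m afterwards. The weak notions all rest on one criterion: ln n is at most a constant times a
    power, with exponent below 1, of s^sigma + eps^(-tau). If gamma_I = 1, the 2^s subsets of
    coordinates defeat WT. *)

(** The fundamental theorem of calculus on [[a n, b n]] followed by dominated convergence with bound
    |f|. It serves both Stein's identity on the line and the Gamma recursion on the half-line. *)
Lemma improper_Rintegral_derive_eq0 (R : realType) (D : set R) (a b : nat -> R)
    (F f : R -> R) :
  measurable D -> (forall n, a n < b n) -> (forall n, `[a n, b n] `<=` D) ->
  (forall x, D x -> \forall n \near \oo, x \in `[a n, b n]) ->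
  (forall x, D x -> is_derive x (1 : R) F (f x)) ->
  (forall x, D x -> {for x, continuous f}) ->
  (@lebesgue_measure R).-integrable D (EFin \o f) ->
  F (b n) - F (a n) @[n --> \oo] --> (0 : R) ->
  \int[lebesgue_measure]_(x in D) f x = 0.
Proof.
move=> mD ab abD Dab dF cf If F0.
pose f_ n : R -> \bar R := (EFin \o f) \_ `[a n, b n].
have mf := measurable_int _ If.
have [|||||_ _] := @dominated_convergence _ _ _ (@lebesgue_measure R) D mD
    f_ (EFin \o f) (abse \o (EFin \o f)).
- move=> n.
  apply/(measurable_restrict (EFin \o f) (measurable_itv `[a n, b n]) mD).
  by apply: measurable_funS mf => //; exact: subIsetl.
- by [].
- apply: aeW => x Dx; apply: cvg_near_cst; near=> n.
  rewrite /f_ patchE ifT// inE; near: n; exact: Dab.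
- exact: integrable_abse.
- apply: aeW => x n Dx; rewrite /f_ patchE; case: ifPn => // _.
  by rewrite abse0 abse_ge0.
have -> : (fun n => \int[lebesgue_measure]_(x in D) f_ n x)%E =
          (fun n => (F (b n) - F (a n))%:E).
  apply/funext => n.
  have cF x : D x -> {for x, continuous F}.
    move=> /dF H; apply/differentiable_continuous/derivable1_diffP.
    exact: (@ex_derive _ _ _ _ _ _ _ H).
  rewrite /f_ -integral_mkcondr setIidr//.
  rewrite EFinB -(@continuous_FTC2 R f F (a n) (b n)) //.
  - apply: continuous_in_subspaceT => x /set_mem xab; apply: cf; exact: (abD n).
  - split.
    + move=> x xab; apply: (@ex_derive _ _ _ _ _ _ (f x)); apply: dF.
      by apply: (abD n); apply: subset_itv_oo_cc.
    + apply: cvg_at_right_filter; apply: cF; apply: (abD n).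
      by rewrite /= in_itv/= lexx (ltW (ab n)).
    + apply: cvg_at_left_filter; apply: cF; apply: (abD n).
      by rewrite /= in_itv/= lexx (ltW (ab n)).
  - move=> x xab; rewrite derive1E; apply: (@derive_val _ _ _ _ _ _ (f x)).
    by apply: dF; apply: (abD n); apply: subset_itv_oo_cc.
move=> H; have : (F (b n) - F (a n))%:E @[n --> \oo] --> 0%:E.
  by apply: cvg_EFin => //; apply: nearW.
by move/(cvg_unique _ H) => //; rewrite /Rintegral => ->.
Unshelve. all: by end_near. Qed.
(** The n-th power of u / n <= 1 + u / n <= exp (u / n). *)
Lemma expr_le_expR (R : realType) (n : nat) (u : R) :
  0 <= u -> u ^+ n <= n%:R ^+ n * expR u.
Proof.
case: n => [|n] u0; first by rewrite !expr0 mul1r -[leLHS]expR0 ler_expR.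
rewrite -ler_pdivrMl ?exprn_gt0// -exprVn -exprMn mulrC.
rewrite -[X in expR X](divfK (_ : n.+1%:R != 0)) ?pnatr_eq0// expRM_natr.
apply: lerXn2r; rewrite ?nnegrE ?expR_ge0 ?divr_ge0//.
by apply: le_trans (expR_ge1Dx _); rewrite lerDr.
Qed.

(** The exponent x^2 / 4 is half of that in the Gaussian, so a polynomial times [phi] is still
    dominated by a multiple of exp (- x^2 / 4). Monomials are reduced to even powers by |x^i| <= 1 +
    x^(2i). *)
Lemma normr_horner_le_expR (R : realType) (p : {poly R}) :
  exists2 C : R, 0 <= C & forall x, `|p.[x]| <= C * expR ((x / 2) ^+ 2).
Proof.
pose c i : R := 1 + 4 ^+ i * i%:R ^+ i.
exists (\sum_(i < size p) `|p`_i| * c i).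
  by apply: sumr_ge0 => i _; rewrite mulr_ge0// addr_ge0// mulr_ge0// exprn_ge0.
move=> x; rewrite horner_coef; apply: le_trans (ler_norm_sum _ _ _) _.
rewrite mulr_suml; apply: ler_sum => i _; rewrite normrM -mulrA.
apply: ler_wpM2l => //.
have := expr_le_expR i (sqr_ge0 (x / 2)); set E := expR _ => H.
have E1 : 1 <= E by rewrite -[leLHS]expR0 ler_expR sqr_ge0.
have -> : c i * E = E + 4 ^+ i * (i%:R ^+ i * E) by rewrite /c; ring.
have : (x ^+ 2) ^+ i <= 4 ^+ i * (i%:R ^+ i * E).
  have -> : x ^+ 2 = 4 * (x / 2) ^+ 2 by field.
  by rewrite exprMn ler_wpM2l// exprn_ge0.
have : `|x ^+ i| <= 1 + (x ^+ 2) ^+ i.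
  rewrite -exprM mulnC exprM -(real_normK (num_real (x ^+ i))).
  by set t := `|_|; nra.
lra.
Qed.

Lemma phi_gt0 (R : realType) (x : R) : 0 < phi x.
Proof. by rewrite mulr_gt0 ?expR_gt0// invr_gt0 sqrtr_gt0 mulr_gt0 ?pi_gt0. Qed.

Lemma phiE (R : realType) : @phi R = normal_pdf 0 1.
Proof.
apply/funext => x; rewrite normal_pdfE ?oner_neq0// /phi /normal_peak /normal_fun.
rewrite subr0 expr1n mul1r -(mulr_natl pi); congr (_^-1 * expR _).
by rewrite mulNr.
Qed.
Lemma measurable_horner (R : realType) (p : {poly R}) :
  measurable_fun [set: R] (horner p).
Proof. by apply: continuous_measurable_fun; exact: continuous_horner. Qed.
Lemma measurable_phi (R : realType) : measurable_fun [set: R] (@phi R).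
Proof. by rewrite phiE; exact: measurable_normal_pdf. Qed.

Lemma integrable_horner_phi (R : realType) (p : {poly R}) :
  (@mu R).-integrable [set: R] (fun x => (p.[x] * phi x)%:E).
Proof.
have s0 : Num.sqrt 2 != 0 :> R by rewrite gt_eqF// sqrtr_gt0.
have [C C0 pC] := normr_horner_le_expR p.
(* The dominating function exp (- x^2 / 4) is, up to its peak, the normal density of standard
   deviation sqrt 2; [K] exchanges the two normalizing constants. *)
pose K := C * (Num.sqrt (2 * pi))^-1 * (normal_peak (Num.sqrt 2 : R))^-1.
have := integrableZl measurableT K (integrable_normal_pdf 0 (Num.sqrt 2)).
apply: le_integrable => //.
- apply/measurable_EFinP/measurable_funM.
    exact: measurable_horner.
  exact: measurable_phi.
- move=> x _; rewrite -EFinM lee_fin [leRHS]ger0_norm; last first.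
    by rewrite mulr_ge0 ?normal_pdf_ge0// !mulr_ge0// invr_ge0 ?normal_peak_ge0.
  rewrite normrM (ger0_norm (ltW (phi_gt0 x))) normal_pdfE//.
  rewrite /K -!mulrA mulKf; last by rewrite gt_eqF// normal_peak_gt0.
  rewrite mulrCA [leRHS]mulrCA /phi; apply: ler_wpM2l => //.
  apply: (le_trans (ler_wpM2r (expR_ge0 _) (pC x))).
  rewrite -mulrA ler_wpM2l// -expRD ler_expR subr0 sqr_sqrtr// -mulr_natr; lra.
Qed.
Lemma is_derive_horner_phi (R : realType) (p : {poly R}) (x : R) :
  is_derive x (1 : R) (fun y => p.[y] * phi y) ((p^`() - 'X * p).[x] * phi x).
Proof.
have dphi : is_derive x (1 : R) (@phi R) (- x * phi x).
  have -> : @phi R = (Num.sqrt (2 * pi))^-1 \*: (expR \o (fun y => - (y ^+ 2 / 2))).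
    by apply/funext.
  have d2 : is_derive x (1 : R) (fun y => - (y ^+ 2 / 2)) (- x).
    have -> : (fun y : R => - (y ^+ 2 / 2)) = horner (- (2^-1 *: 'X^2)).
      by apply/funext => y; rewrite hornerN hornerZ hornerXn mulrC.
    apply: is_derive_eq; rewrite derivN derivZ derivXn hornerN hornerZ /=.
    by rewrite hornerMn hornerXn; field.
  have d1 : is_derive x (1 : R) (expR \o (fun y => - (y ^+ 2 / 2)))
      (- x * expR (- (x ^+ 2 / 2))).
    by apply: is_derive_eq; rewrite mulrC.
  by apply: is_derive_eq; exact: mulrCA.
apply: (@is_derive_eq _ _ _ (horner p * @phi R)).
transitivity (p.[x] * (- x * phi x) + phi x * p^`().[x]); first by [].
by rewrite hornerD hornerN hornerM hornerX; ring.
Qed.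

Lemma cvg_horner_phi (R : realType) (p : {poly R}) :
  p.[n%:R] * phi n%:R @[n --> \oo] --> (0 : R) /\
  p.[- n%:R] * phi (- n%:R) @[n --> \oo] --> (0 : R).
Proof.
suff H (q : {poly R}) : q.[n%:R] * phi n%:R @[n --> \oo] --> (0 : R).
  split; first exact: H.
  have -> : (fun n : nat => p.[- n%:R] * phi (- n%:R)) =
            (fun n : nat => (p \Po (- 'X)).[n%:R] * phi (n%:R : R)).
    by apply/funext => n; rewrite horner_comp !hornerE /phi sqrrN.
  exact: H.
have [C C0 qC] := normr_horner_le_expR q.
pose K := C * (Num.sqrt (2 * pi))^-1.
have K0 : 0 <= K by rewrite mulr_ge0// invr_ge0 sqrtr_ge0.
apply/norm_cvg0P; apply: (@squeeze_cvgr _ _ _ _ (cst 0) (fun n => 4 * K * harmonic n)).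
- near=> n; rewrite normr_ge0/= normrM (ger0_norm (ltW (phi_gt0 _))).
  apply: (le_trans (ler_wpM2r (ltW (phi_gt0 _)) (qC n%:R))).
  rewrite /phi mulrACA mulrA -mulrA -expRD -/K.
  have -> : (n%:R / 2) ^+ 2 - n%:R ^+ 2 / 2 = - (n%:R / 2) ^+ 2 :> R by field.
  rewrite expRN -mulrA mulrCA; apply: ler_wpM2l => //.
  (* It remains to see (n + 1) / 4 <= 1 + n^2 / 4 <= exp (n^2 / 4). *)
  rewrite /= -[X in _ <= X]invrK invfM invrK lef_pV2 ?posrE ?expR_gt0//.
  apply: le_trans (expR_ge1Dx _); rewrite -[n.+1%:R]natr1.
  by have := sqr_ge0 (n%:R - 2^-1 : R); nra.
- exact: cvg_cst.
- rewrite -[X in _ --> X](mulr0 (4 * K)); apply: cvgMr.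
  exact: cvg_harmonic.
Unshelve. all: by end_near. Qed.
(* Both sides differ by the integral of (p phi)' = (p' - 'X p) phi. *)
Lemma Rintegral_stein (R : realType) (p : {poly R}) :
  \int[mu]_x (('X * p).[x] * phi x) = \int[mu]_x (p^`().[x] * phi x) :> R.
Proof.
have [cp cn] := cvg_horner_phi p.
have H : \int[mu]_x ((p^`() - 'X * p).[x] * phi x) = 0 :> R.
  apply: (@improper_Rintegral_derive_eq0 R setT (fun n => - n.+1%:R)
    (fun n => n.+1%:R) (fun y => p.[y] * phi y)) => //.
  - by move=> n; rewrite gtrN.
  - move=> x _; near=> n; rewrite in_itv/= -ler_norml.
    apply: le_trans (ltW (archi_boundP (normr_ge0 x))) _.
    rewrite ler_nat; apply: leqW; near: n; exact: nbhs_infty_ge.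
  - by move=> x _; exact: is_derive_horner_phi.
  - move=> x _; apply: continuousM; first exact: continuous_horner.
    by rewrite phiE; apply: continuous_normal_pdf; exact: oner_neq0.
  - exact: integrable_horner_phi.
  - rewrite -[X in _ --> X](subrr 0); apply: cvgB.
    + by move: cp; rewrite -cvg_shiftS.
    + by move: cn; rewrite -cvg_shiftS.
apply/eqP; rewrite eq_sym -subr_eq0 -RintegralB//.
- rewrite -[X in _ == X]H; apply/eqP; apply: eq_Rintegral => x _.
  by rewrite hornerD hornerN mulrBl.
- exact: integrable_horner_phi.
- exact: integrable_horner_phi.
Unshelve. all: by end_near. Qed.

(** The monic (probabilists') Hermite polynomials; [hermite k] is this polynomial divided by sqrt
    (k!). *)
Fixpoint hermite_poly (R : realType) (k : nat) : {poly R} :=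
  if k is k'.+1 then 'X * hermite_poly R k' - (hermite_poly R k')^`() else 1.

(** Differentiating h exp (- x^2 / 2) produces (h' - x h) exp (- x^2 / 2), the negative of the next
    step of the recursion; hence the sign (-1)^k. *)
Lemma derive1n_gauss (R : realType) (k : nat) :
  derive1n k (fun y : R => expR (- (y ^+ 2 / 2))) =
  (fun y => (-1) ^+ k * (hermite_poly R k).[y] * expR (- (y ^+ 2 / 2))).
Proof.
pose c : R := Num.sqrt (2 * pi).
have c0 : c != 0 by rewrite gt_eqF// sqrtr_gt0 mulr_gt0 ?pi_gt0.
have pE (x : R) : expR (- (x ^+ 2 / 2)) = c * phi x by rewrite mulrA divff// mul1r.
elim: k => [|k IHk].
  by rewrite derive1n0; apply/funext => x; rewrite expr0 hornerC !mul1r.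
rewrite derive1nS IHk; apply/funext => x.
have -> : (fun y : R => (-1) ^+ k * (hermite_poly R k).[y] * expR (- (y ^+ 2 / 2))) =
   (c * (-1) ^+ k) \*: (fun y => (hermite_poly R k).[y] * phi y).
  apply/funext => y; rewrite pE.
  transitivity (c * (-1) ^+ k * ((hermite_poly R k).[y] * phi y)); last by [].
  by ring.
rewrite derive1E; have := is_derive_horner_phi (hermite_poly R k) x => H.
rewrite deriveZ; last by apply: (@ex_derive _ _ _ _ _ _ _ H).
rewrite (@derive_val _ _ _ _ _ _ _ H) pE.
set p := hermite_poly R k.
transitivity (c * (-1) ^+ k * ((p^`() - 'X * p).[x] * phi x)); first by [].
by rewrite exprS /= -/p !(hornerD, hornerN, hornerM, hornerX); ring.
Qed.

Lemma hermiteE (R : realType) (k : nat) (x : R) :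
  hermite k x = (Num.sqrt (k`!%:R))^-1 * (hermite_poly R k).[x].
Proof.
rewrite /hermite derive1n_gauss expRN.
set e := expR _; set s := Num.sqrt _; set h := _.[x].
have e0 : e != 0 by rewrite gt_eqF// expR_gt0.
transitivity (((-1) ^+ k) ^+ 2 * (s^-1 * h) * (e * e^-1)); first by ring.
by rewrite divff// mulr1 -exprM mulnC exprM sqrrN !expr1n mul1r.
Qed.
Lemma size_hermite_poly (R : realType) (k : nat) : size (hermite_poly R k) = k.+1.
Proof.
elim: k => [|k IHk] /=; first by rewrite size_poly1.
have h0 : hermite_poly R k != 0 by rewrite -size_poly_eq0 IHk.
rewrite mulrC size_polyDl size_mulX ?IHk// size_polyN.
by apply: ltn_trans (lt_size_deriv h0) _; rewrite IHk.
Qed.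

Lemma hermite_poly_monic (R : realType) (k : nat) : hermite_poly R k \is monic.
Proof.
elim: k => [|k IHk] /=; first exact: monic1.
have h0 := monic_neq0 IHk.
rewrite monicE mulrC lead_coefDl ?lead_coefMX//.
by rewrite size_polyN size_mulX//; apply: ltn_trans (lt_size_deriv h0) _.
Qed.

(** Integration by parts k times. In ('X p - p') q, Stein's identity replaces 'X (p q) by (p q)' =
    p' q + p q', which leaves p q'. *)
Lemma Rintegral_hermite_polyM (R : realType) (k : nat) (q : {poly R}) :
  \int[mu]_x ((hermite_poly R k * q).[x] * phi x) =
  \int[mu]_x (q^`(k).[x] * phi x) :> R.
Proof.
elim: k q => [|k IHk] q; first by rewrite mul1r derivn0.
rewrite derivSn -IHk /=; set p := hermite_poly R k.
have -> : ('X * p - p^`()) * q = 'X * (p * q) - p^`() * q by ring.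
under eq_Rintegral => x _ do rewrite hornerD hornerN mulrBl.
rewrite RintegralB//; [|exact: integrable_horner_phi..].
rewrite Rintegral_stein derivM.
under eq_Rintegral => x _ do rewrite hornerD mulrDl.
by rewrite RintegralD//; [ring|exact: integrable_horner_phi..].
Qed.

Lemma Rintegral_hermite_poly (R : realType) (k l : nat) :
  \int[mu]_x ((hermite_poly R k * hermite_poly R l).[x] * phi x) =
  (k == l)%:R * k`!%:R :> R.
Proof.
wlog kl : k l / (l <= k)%N.
  move=> H; have [/H//|/ltnW/H] := leqP l k; rewrite mulrC eq_sym => ->.
  by case: eqVneq => [->|]; rewrite ?mul0r.
have E1 : \int[mu]_x phi x = 1 :> R.
  by rewrite phiE /Rintegral integral_normal_pdf.
rewrite Rintegral_hermite_polyM.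
(* A monic polynomial of degree l <= k has k-th derivative k! if l = k, and 0 otherwise. *)
have -> : (hermite_poly R l)^`(k) = ((k == l)%:R * k`!%:R)%:P.
  apply/polyP => i; rewrite coef_derivn coefC; case: i => [|i] /=; last first.
    rewrite nth_default ?mul0rn// size_hermite_poly addnS ltnS.
    exact: leq_trans kl (leq_addr _ _).
  rewrite addn0 ffactnn; case: eqVneq => [->|lk].
    have := hermite_poly_monic R l; rewrite monicE /lead_coef size_hermite_poly.
    by move=> /= /eqP ->; rewrite mul1r.
  by rewrite nth_default ?mul0rn ?mul0r// size_hermite_poly ltn_neqAle eq_sym lk.
under eq_Rintegral => x _ do rewrite hornerC.
rewrite RintegralZl ?E1 ?mulr1//.
have -> : (EFin \o @phi R) = fun x => ((1 : {poly R}).[x] * phi x)%:E.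
  by apply/funext => x; rewrite hornerC mul1r.
exact: integrable_horner_phi.
Qed.

Lemma hermite_orthonormal (R : realType) (k l : nat) :
  \int[mu]_x (hermite k x * hermite l x * phi x) = (k == l)%:R :> R.
Proof.
have -> : (fun x : R => hermite k x * hermite l x * phi x) =
  (fun x => ((Num.sqrt (k`!%:R))^-1 * (Num.sqrt (l`!%:R))^-1) *
     ((hermite_poly R k * hermite_poly R l).[x] * phi x)).
  by apply/funext => x; rewrite !hermiteE hornerM; ring.
rewrite RintegralZl//; last exact: integrable_horner_phi.
rewrite Rintegral_hermite_poly; case: eqVneq => [->|_]; last by rewrite mul0r mulr0.
rewrite mul1r -invfM -expr2 sqr_sqrtr// mulVf// pnatr_eq0 -lt0n; exact: fact_gt0.
Qed.

Lemma integrable_hermiteM (R : realType) (k l : nat) :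
  (@mu R).-integrable [set: R] (fun x => (hermite k x * hermite l x * phi x)%:E).
Proof.
have -> : (fun x : R => (hermite k x * hermite l x * phi x)%:E) =
  (fun x => ((Num.sqrt (k`!%:R))^-1 * (Num.sqrt (l`!%:R))^-1)%:E *
     ((hermite_poly R k * hermite_poly R l).[x] * phi x)%:E)%E.
  by apply/funext => x; rewrite !hermiteE hornerM -EFinM; congr EFin; ring.
by apply: integrableZl => //; exact: integrable_horner_phi.
Qed.

Lemma measurable_hermite (R : realType) (k : nat) :
  measurable_fun [set: R] (@hermite R k).
Proof.
have -> : @hermite R k = fun x => (Num.sqrt (k`!%:R))^-1 * (hermite_poly R k).[x].
  by apply/funext => x; exact: hermiteE.
by apply: measurable_funM => //; exact: measurable_horner.
Qed.

(** * The Fourier weights *)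

Lemma powR_le1DX (R : realType) (y t : R) (n : nat) :
  0 < t -> 0 <= y <= n%:R -> t `^ y <= 1 + t ^+ n.
Proof.
move=> t0 /andP[y0 yn]; have [t1|t1] := leP t 1.
  apply: (@le_trans _ _ 1); last by rewrite lerDl exprn_ge0// ltW.
  by rewrite -(powRr0 t) ger_powR// t0.
apply: (@le_trans _ _ (t ^+ n)); last by rewrite lerDr.
by rewrite -powR_mulrn ?(ltW t0)// ler_powR// ltW.
Qed.

Lemma powR_le_expR (R : realType) (y : R) : 0 <= y ->
  exists2 C : R, 0 < C & forall t, 0 < t -> t `^ y <= C * expR (t / 2).
Proof.
move=> y0; pose n := Num.bound y.
have yn : 0 <= y <= n%:R by rewrite y0 ltW// archi_boundP.
exists (1 + 2 ^+ n * n%:R ^+ n); first by rewrite ltr_pwDl// mulr_ge0// exprn_ge0.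
move=> t t0; apply: le_trans (powR_le1DX t0 yn) _.
have t20 : 0 <= t / 2 by rewrite divr_ge0// ltW.
rewrite mulrDl mul1r lerD//.
  by rewrite -[leLHS]expR0 ler_expR.
have -> : t = 2 * (t / 2) by field.
rewrite exprMn -mulrA ler_wpM2l ?exprn_ge0// [2 * _]mulrC mulfK//.
exact: expr_le_expR.
Qed.

(** * Euler's Gamma integral and the generalized factorial *)

Lemma measurable_Gamma_fun (R : realType) (y : R) :
  measurable_fun [set: R] (fun t : R => t `^ y * expR (- t)).
Proof.
apply: measurable_funM; first exact: measurable_powR.
by apply: measurableT_comp => //; exact: measurable_funN.
Qed.

(** Since t^y <= C exp (t / 2), the integrand is dominated by a multiple of the exponential density
    of rate 1/2. *)
Lemma integrable_Gamma_fun (R : realType) (y : R) : 0 <= y ->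
  (@mu R).-integrable (`]0, +oo[%classic : set R)
    (fun t => (t `^ y * expR (- t))%:E).
Proof.
move=> y0; have [C C0 H] := powR_le_expR y0.
have h0 : 0 < 2^-1 :> R by [].
have I := integrableZl measurableT (2 * C) (integrable_exponential_pdf h0).
have {I} : (@mu R).-integrable (`]0, +oo[%classic : set R)
    (fun t => (2 * C)%:E * (EFin \o exponential_pdf 2^-1) t)%E.
  by apply: integrableS I.
apply: le_integrable => //.
  by apply/measurable_EFinP/measurable_funTS; exact: measurable_Gamma_fun.
move=> t /=; rewrite in_itv/= andbT => t0.
rewrite exponential_pdfE ?(ltW t0)// lee_fin.
rewrite (ger0_norm (_ : 0 <= t `^ y * _)) ?mulr_ge0 ?powR_ge0 ?expR_ge0//.
apply: le_trans _ (ler_norm _).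
have -> : 2 * C * (2^-1 * expR (- 2^-1 * t)) = C * expR (- 2^-1 * t) by field.
apply: le_trans (ler_wpM2r (expR_ge0 _) (H _ t0)) _.
by rewrite -mulrA -expRD ler_wpM2l ?(ltW C0)// ler_expR; lra.
Qed.

(** The derivative of t^(y+1) exp (- t) is (y + 1) t^y exp (- t) - t^(y+1) exp (- t), and the
    primitive vanishes at 0 and at infinity. *)
Lemma Gamma_rec (R : realType) (y : R) : 0 <= y ->
  Gamma (y + 2) = (y + 1) * Gamma (y + 1).
Proof.
move=> y0; rewrite /Gamma.
have -> : y + 2 - 1 = y + 1 by ring.
have -> : y + 1 - 1 = y by ring.
have y10 : 0 <= y + 1 by rewrite addr_ge0.
have iy := integrable_Gamma_fun y0.
have iy1 := integrable_Gamma_fun y10.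
have I1 : (@mu R).-integrable (`]0, +oo[%classic : set R)
    (fun t => (y + 1)%:E * (t `^ y * expR (- t))%:E)%E.
  exact: integrableZl.
have H : \int[mu]_(t in `]0, +oo[) ((y + 1) * (t `^ y * expR (- t)) -
    t `^ (y + 1) * expR (- t)) = 0 :> R.
  (* The left end stays away from 0, so that real powers are differentiable on the interval; [n.+2]
     keeps it nondegenerate at n = 0. *)
  apply: (@improper_Rintegral_derive_eq0 R _ (fun n => n.+1%:R^-1)
    (fun n => n.+2%:R) (fun t => t `^ (y + 1) * expR (- t))) => //.
  - move=> n; apply: (@le_lt_trans _ _ 1); last by rewrite ltr1n.
    by rewrite invf_le1 ?ler1n.
  - move=> n t /=; rewrite !in_itv/= andbT => /andP[+ _]; exact: lt_le_trans.
  - move=> t /=; rewrite in_itv/= andbT => t0; near=> n; rewrite in_itv/=.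
    apply/andP; split.
      rewrite invf_ple ?posrE//.
      apply: le_trans (ltW (archi_boundP _)) _; first by rewrite invr_ge0 ltW.
      rewrite ler_nat; apply: leqW; near: n; exact: nbhs_infty_ge.
    apply: le_trans (ltW (archi_boundP (ltW t0))) _.
    rewrite ler_nat; do 2! apply: leqW; near: n; exact: nbhs_infty_ge.
  - move=> t /=; rewrite in_itv/= andbT => t0.
    have d1 := is_derive1_powR (y + 1) t0.
    have d2 : is_derive t (1 : R) (expR \o -%R) (expR (- t) * - 1).
      exact: is_derive1_comp.
    apply: (is_derive_eq (is_deriveM d1 d2)).
    transitivity (t `^ (y + 1) * (expR (- t) * - 1) +
      expR (- t) * ((y + 1) * t `^ (y + 1 - 1))); first by [].
    by rewrite addrK; ring.
  - move=> t /=; rewrite in_itv/= andbT => t0.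
    have cp z : {for t, continuous (fun t : R => t `^ z)}.
      apply/differentiable_continuous/derivable1_diffP.
      by apply: ex_derive; exact: is_derive1_powR.
    have ce : {for t, continuous (fun t : R => expR (- t))}.
      by apply: continuous_comp; [exact: continuousN|exact: continuous_expR].
    apply: continuousB; last exact: continuousM.
    by apply: continuousM; [exact: cst_continuous|exact: continuousM].
  - have mD : measurable (`]0, +oo[%classic : set (measurableTypeR R)).
      exact: measurable_itv.
    by have := integrableB mD I1 iy1.
  - have [C C0 HC] := powR_le_expR y10.
    rewrite -[X in _ --> X](subrr 0); apply: cvgB.
      apply: (@squeeze_cvgr _ _ _ _ (cst 0) (fun n => 2 * C * harmonic n)).
      + apply: nearW => n; rewrite mulr_ge0 ?powR_ge0 ?expR_ge0//=.
        apply: le_trans (ler_wpM2r (expR_ge0 _) (HC _ _)) _ => //.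
        rewrite -[leLHS]mulrA -expRD (mulrC 2) -mulrA ler_pM2l//.
        have -> : n.+2%:R / 2 - n.+2%:R = - (n.+2%:R / 2) :> R by field.
        rewrite expRN -[leRHS]invrK lef_pV2 ?posrE ?expR_gt0//.
        rewrite invfM invrK; apply: le_trans (expR_ge1Dx _).
        by rewrite -[n.+2%:R]natr1; lra.
      + exact: cvg_cst.
      + by rewrite -[X in _ --> X](mulr0 (2 * C)); apply: cvgMl_tmp; exact: cvg_harmonic.
    apply: (@squeeze_cvgr _ _ _ _ (cst 0) harmonic) => //.
    + apply: nearW => n; rewrite mulr_ge0 ?powR_ge0 ?expR_ge0//=.
      rewrite -[leRHS]mulr1; apply: ler_pM; rewrite ?powR_ge0 ?expR_ge0//.
      by rewrite ge1r_powR ?lerDr// invr_gt0 ltr0n invf_le1 ?ler1n.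
    + exact: cvg_cst.
    + exact: cvg_harmonic.
move: H; rewrite RintegralB//.
by rewrite RintegralZl// => /eqP; rewrite subr_eq0 => /eqP.
Unshelve. all: end_near. Qed.
Lemma Gamma1 (R : realType) : Gamma (1 : R) = 1.
Proof.
rewrite /Gamma subrr /Rintegral.
have := @integral_exponential_pdf R 1 ltr01.
have -> : (\int[mu]_x (exponential_pdf 1 x)%:E =
   \int[mu]_(t in `]0%R, +oo[) ((t : R) `^ 0 * expR (- t))%:E)%E.
  rewrite [RHS]integral_itv_obnd_cbnd; last first.
    exact: measurable_int (integrable_Gamma_fun (lexx 0)).
  rewrite [RHS]integral_mkcond; apply: eq_integral => x _.
  rewrite /exponential_pdf !patchE; case: ifPn => // _.
  by rewrite powRr0 !mul1r mulN1r.
by move=> ->.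
Qed.

(** From t^y <= 1 + t, the value is at most Gamma 1 + Gamma 2 = 2. *)
Lemma Gamma_le2 (R : realType) (y : R) : 0 <= y <= 1 -> Gamma (y + 1) <= 2.
Proof.
move=> /[dup] /andP[y0 _] y01.
have E1 : \int[mu]_(t in `]0, +oo[) (t `^ 0 * expR (- t)) = 1 :> R.
  by rewrite -[RHS]Gamma1 /Gamma subrr.
have E2 : \int[mu]_(t in `]0, +oo[) (t `^ 1 * expR (- t)) = 1 :> R.
  have G2 : Gamma (2 : R) = 1.
    by have := @Gamma_rec R 0 (lexx 0); rewrite !add0r Gamma1 mulr1.
  by rewrite -[RHS]G2 /Gamma (_ : 2 - 1 = 1)//; ring.
have I0 := integrable_Gamma_fun (lexx (0 : R)).
have I1 := integrable_Gamma_fun (@ler01 R).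
have Iy := integrable_Gamma_fun y0.
apply: (@le_trans _ _ (\int[mu]_(t in `]0, +oo[) (t `^ 0 * expR (- t)) +
    \int[mu]_(t in `]0, +oo[) (t `^ 1 * expR (- t)))); last by rewrite E1 E2.
rewrite -RintegralD// /Gamma addrK.
apply: le_Rintegral => //.
  have mD : measurable (`]0, +oo[%classic : set (measurableTypeR R)).
    exact: measurable_itv.
  by have := integrableD mD I0 I1.
move=> t /=; rewrite in_itv/= andbT => t0.
rewrite -mulrDl ler_wpM2r ?expR_ge0// powRr0 powRr1 ?(ltW t0)//.
exact: (@powR_le1DX _ _ _ 1).
Qed.

(** On [1, 2] the integrand is at least exp (- 2), and that interval has length 1. *)
Lemma Gamma_gt0 (R : realType) (y : R) : 0 <= y -> 0 < Gamma (y + 1).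
Proof.
move=> y0; have Iy := integrable_Gamma_fun y0.
rewrite /Gamma addrK -lte_fin /Rintegral fineK; last exact: integrable_fin_num.
have sub : `[1, 2] `<=` (`]0, +oo[%classic : set R).
  by move=> t /=; rewrite !in_itv/= andbT => /andP[t1 _]; apply: lt_le_trans t1.
have mI : measurable (`[1, 2]%classic : set (measurableTypeR R)).
  exact: measurable_itv.
have mD : measurable (`]0, +oo[%classic : set (measurableTypeR R)).
  exact: measurable_itv.
have mf := measurable_int _ Iy.
apply: (@lt_le_trans _ _
  (\int[mu]_(t in `[1%R, 2%R]) ((t : R) `^ y * expR (- t))%:E)%E); last first.
  apply: ge0_subset_integral => //.
  by move=> t _; rewrite lee_fin mulr_ge0 ?powR_ge0 ?expR_ge0.
apply: (@lt_le_trans _ _ (\int[mu]_(t in `[1%R, 2%R]) (cst (expR (- 2))%:E (t : R)))%E).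
  rewrite integral_cst//= lebesgue_measure_itv/= lte_fin ltr1n/= -EFinD -EFinM lte_fin.
  by rewrite mulr_gt0 ?expR_gt0// subr_gt0 ltr1n.
apply: ge0_le_integral => //.
- by move=> t _; rewrite lee_fin expR_ge0.
- by apply: measurable_funS mf.
move=> t /=; rewrite in_itv/= lee_fin => /andP[t1 t2].
rewrite -[leLHS]mul1r ler_pM ?expR_ge0// ?ler_expR ?lerN2//.
by rewrite -(powRr0 t) ler_powR.
Qed.
Lemma rfact_nat (R : realType) (m : nat) : rfact (m%:R : R) = m`!%:R.
Proof. by rewrite /rfact natr_nat natrK. Qed.

Lemma rfactS (R : realType) (x : R) : 0 <= x -> rfact (x + 1) = (x + 1) * rfact x.
Proof.
move=> x0; have [/natrP[m ->]|xn] := boolP (x \is a Num.nat).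
  by rewrite natr1 !rfact_nat factS natrM.
rewrite /rfact (negbTE xn) ifN.
  by rewrite -[x + 1 + 1]addrA Gamma_rec.
apply: contra xn => /natrP[[|m] /eqP]; first by rewrite gt_eqF// ltr_pwDr.
by rewrite -natr1 => /eqP/addIr ->; exact: natr_nat.
Qed.

Lemma rfact_gt0 (R : realType) (x : R) : 0 <= x -> 0 < rfact x.
Proof.
move=> x0; rewrite /rfact; case: ifP => _; last exact: Gamma_gt0.
by rewrite ltr0n fact_gt0.
Qed.

Lemma rfact_le2 (R : realType) (x : R) : 0 <= x < 1 -> rfact x <= 2.
Proof.
move=> /andP[x0 x1]; rewrite /rfact; case: ifPn => [/natrP[m xm]|_].
  by move: x1; rewrite xm natrK ltrn1 ltnS leqn0 => /eqP ->; rewrite ler1n.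
by apply: Gamma_le2; rewrite x0 ltW.
Qed.

(** A power of 1 + 1/t <= exp (1/t). With its companion for t - 1 it lets the ratios of successive
    weights be matched against ratios of powers. *)
Lemma powR_succ_le (R : realType) (a t : R) : 0 <= a -> 0 < t ->
  (t + 1) `^ a <= expR (a / t) * t `^ a.
Proof.
move=> a0 t0; have -> : t + 1 = (1 + t^-1) * t by rewrite mulrDl mul1r mulVf ?gt_eqF.
rewrite powRM ?(ltW t0)// ?addr_ge0 ?invr_ge0 ?(ltW t0)// ler_wpM2r ?powR_ge0//.
rewrite mulrC expRM; apply: ge0_ler_powR => //.
- by rewrite nnegrE addr_ge0 ?invr_ge0 ?(ltW t0).
- by rewrite nnegrE expR_ge0.
- exact: expR_ge1Dx.
Qed.

Lemma powR_pred_le (R : realType) (a t : R) : 0 <= a -> 1 < t ->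
  (t - 1) `^ a <= expR (- (a / t)) * t `^ a.
Proof.
move=> a0 t1; have t0 : 0 < t := lt_trans ltr01 t1.
have -> : t - 1 = (1 - t^-1) * t by rewrite mulrBl mul1r mulVf ?gt_eqF.
have u0 : 0 <= 1 - t^-1 by rewrite subr_ge0 invf_le1// ltW.
rewrite powRM ?(ltW t0)// ler_wpM2r ?powR_ge0//.
rewrite mulrC -mulNr expRM; apply: ge0_ler_powR => //.
- by rewrite nnegrE expR_ge0.
- exact: expR_ge1Dx.
Qed.

(** * Two-sided decay k^(-alpha) of the weights in one variable *)

Section fweight.
Context {R : realType} (alpha : R) (alpha_ge1 : 1 <= alpha).
Local Notation b := (fweight alpha 1).

Lemma fweightE (g : R) (k : nat) : (0 < k)%N -> fweight alpha g k = g * b k.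
Proof. by case: k => // k _; rewrite /fweight/=; case: ifP => _; rewrite !mul1r. Qed.

Lemma fweight_lt (k : nat) : (0 < k)%N -> k%:R < alpha -> b k = (k`!%:R)^-1.
Proof. by case: k => // k _ ka; rewrite /fweight/= ka !mul1r. Qed.

Lemma fweight_ge (k : nat) : alpha <= k%:R -> b k = rfact (k%:R - alpha) / k`!%:R.
Proof.
move=> ak; rewrite /fweight ltNge ak/= mul1r.
by case: k ak => //; rewrite leNgt (lt_le_trans ltr01).
Qed.

Lemma fweight1 : b 1 = 1.
Proof.
have [a1|a1] := ltP 1 alpha; first by rewrite fweight_lt// invr1.
have aE : alpha = 1 by apply/eqP; rewrite eq_le a1.
by rewrite fweight_ge// aE subrr (rfact_nat _ 0) divff.
Qed.

Lemma fweight_gt0 (k : nat) : 0 < b k.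
Proof.
case: k => [|k]; first by rewrite /fweight.
have [ka|ak] := ltP k.+1%:R alpha.
  by rewrite fweight_lt// invr_gt0 ltr0n fact_gt0.
by rewrite fweight_ge// divr_gt0 ?ltr0n ?fact_gt0// rfact_gt0// subr_ge0.
Qed.

Lemma fweight_rec (k : nat) : alpha <= k%:R ->
  b k.+1 = (1 - alpha / k.+1%:R) * b k.
Proof.
move=> ak; have ak1 : alpha <= k.+1%:R by rewrite (le_trans ak)// ler_nat.
rewrite !fweight_ge//.
have -> : k.+1%:R - alpha = k%:R - alpha + 1 by rewrite -natr1; ring.
rewrite rfactS ?subr_ge0// factS natrM -natr1.
field; rewrite pnatr_eq0 -lt0n fact_gt0/= natr1 pnatr_eq0.
by [].
Qed.

(** [K] is the ceiling of alpha, the first index in the factorial branch of [fweight]; from there on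
    [fweight_rec] applies. *)
Lemma exists_ceil : exists K : nat, [/\ (0 < K)%N, alpha <= K%:R & K%:R - 1 < alpha].
Proof.
have ex : exists K : nat, alpha <= K%:R.
  by exists (Num.bound alpha); rewrite ltW// archi_boundP// (le_trans ler01).
case: (ex_minnP ex) => K aK Kmin; exists K.
have K0 : (0 < K)%N by rewrite -(ltr_nat R) (lt_le_trans ltr01)// (le_trans alpha_ge1).
split=> //; rewrite ltNge; apply/negP => aK1.
have : alpha <= K.-1%:R by rewrite -subn1 natrB.
by move=> /Kmin; case: (K) K0 => //= n _; rewrite ltnn.
Qed.

Lemma fweight_le_decr (K k : nat) : alpha <= K%:R -> (K <= k)%N -> b k <= b K.
Proof.
move=> aK /subnK <-; elim: (k - K)%N => [//|n IHn]; rewrite addSn.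
apply: le_trans IHn; have an : alpha <= (n + K)%:R.
  by rewrite (le_trans aK)// ler_nat leq_addl.
rewrite fweight_rec// ler_piMl ?(ltW (fweight_gt0 _))// gerBl.
by rewrite divr_ge0// (le_trans ler01).
Qed.

(** Beyond the first index K >= alpha the weights decrease. At K itself, K - alpha lies in [0, 1),
    so (K - alpha)! <= 2 <= K! once K >= 2, while K = 1 forces alpha = 1. *)
Lemma fweight_le1 (k : nat) : b k <= 1.
Proof.
case: k => [|k]; first by rewrite /fweight.
have [ka|ak] := ltP k.+1%:R alpha.
  by rewrite fweight_lt// invf_le1 ?ltr0n ?fact_gt0// ler1n fact_gt0.
have [K [K0 aK Ka]] := exists_ceil.
have Kk : (K <= k.+1)%N.
  rewrite leqNgt; apply/negP => kK; move: Ka; apply/negP; rewrite -leNgt.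
  by rewrite (le_trans ak)// lerBrDr natr1 ler_nat.
apply: le_trans (fweight_le_decr aK Kk) _.
rewrite fweight_ge// ler_pdivrMr ?ltr0n ?fact_gt0// mul1r.
case: K K0 aK Ka {Kk} => [//|[|K]] _ aK Ka.
  have -> : alpha = 1 by apply/eqP; rewrite eq_le aK alpha_ge1.
  by rewrite subrr (rfact_nat _ 0).
apply: (@le_trans _ _ 2).
  by apply: rfact_le2; rewrite subr_ge0 aK/= ltrBlDr addrC -ltrBlDr.
by rewrite ler_nat (leq_trans _ (fact_geq _)).
Qed.

(* The ratio b k.+1 / b k = 1 - alpha / k.+1 makes b k * k.+1 ^ alpha
   nonincreasing from the first k >= alpha on. *)
Lemma fweight_ub : exists2 C : R, 0 < C &
  forall k, (0 < k)%N -> b k <= C * k%:R `^ (- alpha).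
Proof.
have a0 : 0 <= alpha := le_trans ler01 alpha_ge1.
have [K [K0 aK Ka]] := exists_ceil.
exists (K.+1%:R `^ alpha); first by rewrite powR_gt0.
move=> k k0; rewrite powRN ler_pdivlMr ?powR_gt0 ?ltr0n//.
have [kK|Kk] := leqP k K.
  rewrite -[leRHS]mul1r ler_pM ?powR_ge0 ?(ltW (fweight_gt0 _)) ?fweight_le1//.
  by rewrite ge0_ler_powR ?nnegrE// ler_nat (leq_trans kK).
suff H n : b (n + K) * (n + K).+1%:R `^ alpha <= K.+1%:R `^ alpha.
  have := H (k - K)%N; rewrite subnK 1?ltnW//; apply: le_trans.
  by rewrite ler_pM2l ?fweight_gt0// ge0_ler_powR ?nnegrE// ler_nat.
elim: n => [|n IHn]; first by rewrite ler_piMl ?powR_ge0 ?fweight_le1.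
apply: le_trans IHn; have an : alpha <= (n + K)%:R.
  by rewrite (le_trans aK)// ler_nat leq_addl.
rewrite addSn fweight_rec//; set m := (n + K).+1.
have m0 : 0 < m%:R :> R by [].
have := powR_succ_le a0 m0; rewrite natr1 => H.
rewrite mulrAC mulrC ler_pM2l ?fweight_gt0//.
have H1 : 1 - alpha / m%:R <= expR (- (alpha / m%:R)) by exact: expR_ge1Dx.
apply: le_trans (ler_wpM2r (powR_ge0 _ _) H1) _.
apply: le_trans (ler_wpM2l (expR_ge0 _) H) _.
by rewrite mulrA -expRD addNr expR0 mul1r.
Qed.

(* For k > alpha it makes b k * (k - alpha) ^ alpha nondecreasing. *)
Lemma fweight_lb : exists2 c : R, 0 < c &
  forall k, (0 < k)%N -> c * k%:R `^ (- alpha) <= b k.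
Proof.
have a0 : 0 <= alpha := le_trans ler01 alpha_ge1.
have [K [K0 aK Ka]] := exists_ceil.
have aK1 : alpha <= K.+1%:R by rewrite (le_trans aK)// ler_nat.
have f0 m : 0 < m`!%:R :> R by rewrite ltr0n fact_gt0.
(* One constant for all ranges: the divisor K! handles the weights 1 / k! with k < alpha, and
   [b K.+1] is where the monotone quantity starts for k > K. *)
exists (b K.+1 / K`!%:R); first by rewrite divr_gt0 ?fweight_gt0.
move=> k k0; have kK1 : k%:R `^ (- alpha) <= 1 :> R.
  rewrite powRN invf_le1 ?powR_gt0 ?ltr0n//.
  by rewrite -[leLHS](powRr0 k%:R) ler_powR// ler1n.
have [kK|Kk] := leqP k K.
  apply: (@le_trans _ _ (b K.+1 / K`!%:R)).
    by rewrite ler_piMr// divr_ge0 ?(ltW (fweight_gt0 _)) ?(ltW (f0 _)).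
  have [ka|ak] := ltP k%:R alpha.
    rewrite (fweight_lt k0)// -[leRHS]mul1r ler_pM ?(ltW (fweight_gt0 _)) ?fweight_le1//.
    by rewrite lef_pV2 ?posrE// ler_nat; apply: leq_fact.
  apply: (@le_trans _ _ (b K.+1)); last by apply: fweight_le_decr => //; exact: leqW.
  by rewrite ler_piMr ?(ltW (fweight_gt0 _))// invf_le1// ler1n fact_gt0.
rewrite powRN ler_pdivrMr ?powR_gt0 ?ltr0n//.
apply: (@le_trans _ _ (b K.+1)).
  by rewrite ler_piMr ?(ltW (fweight_gt0 _))// invf_le1// ler1n fact_gt0.
suff H n : b K.+1 <= b (n + K.+1) * ((n + K.+1)%:R - alpha) `^ alpha.
  have := H (k - K.+1)%N; rewrite subnK// => /le_trans; apply.
  rewrite ler_pM2l ?fweight_gt0// ge0_ler_powR ?nnegrE ?gerBl//.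
  by rewrite subr_ge0 (le_trans aK1)// ler_nat.
elim: n => [|n IHn].
  rewrite ler_peMr ?(ltW (fweight_gt0 _))// -[leLHS](powRr0 (K.+1%:R - alpha)).
  by rewrite ler_powR// -natr1; lra.
apply: le_trans IHn _; rewrite addSn; set m := (n + K.+1)%N.
have am : alpha + 1 <= m%:R.
  by rewrite (@le_trans _ _ K.+1%:R)// -?natr1 ?lerD2r// natr1 ler_nat leq_addl.
have am' : alpha <= m%:R by rewrite (le_trans _ am)// lerDl.
have t1 : 1 < m.+1%:R - alpha by rewrite -natr1; lra.
rewrite fweight_rec//; have := powR_pred_le a0 t1.
have -> : m.+1%:R - alpha - 1 = m%:R - alpha by rewrite -natr1; ring.
set t := m.+1%:R - alpha => H.
rewrite [leRHS]mulrAC [leRHS]mulrC ler_pM2l ?fweight_gt0//.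
apply: le_trans H _; rewrite ler_wpM2r ?powR_ge0//.
have t0 : 0 < t := lt_trans ltr01 t1.
(* In this form the ratio is at least exp (- alpha / t), exactly the factor lost from t^alpha to (t
   - 1)^alpha. *)
have -> : 1 - alpha / m.+1%:R = (1 + alpha / t)^-1.
  have tE : m.+1%:R = t + alpha by rewrite subrK.
  have ta : t + alpha != 0 by rewrite gt_eqF// ltr_wpDr.
  by rewrite tE; field; rewrite gt_eqF.
by rewrite expRN lef_pV2 ?posrE ?expR_gt0 ?expR_ge1Dx// ltr_wpDr// divr_ge0// ltW.
Qed.

End fweight.

(** * Hermite functions on R^s *)

Lemma measurable_prod_tnth (R : realType) (s : nat) (f : 'I_s -> R -> R) :
  (forall j, measurable_fun [set: R] (f j)) ->
  measurable_fun [set: Rn R s] (fun x : Rn R s => \prod_(j < s) f j (tnth x j)).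
Proof.
move=> mf; apply: measurable_prod => j _.
apply: (@measurableT_comp _ _ _ _ _ _ (f j)); first exact: mf.
exact: measurable_tnth.
Qed.

Lemma prod_tnth_cons_pair (R : realType) (s : nat) (f : 'I_s.+1 -> R -> R)
    (p : measurableTypeR R * Rn R s) :
  \prod_(j < s.+1) f j (tnth (cons_pair p) j) =
  f ord0 p.1 * \prod_(j < s) f (lift ord0 j) (tnth p.2 j).
Proof.
rewrite big_ord_recl; congr (_ * _).
by apply: eq_bigr => j _; rewrite /cons_pair tnthS.
Qed.

(** Tonelli for the absolute values gives integrability, after which Fubini separates the
    factors. *)
Lemma integrable_mul_prod_measure (R : realType) d1 d2 (T1 : measurableType d1)
    (T2 : measurableType d2) (m1 : {sigma_finite_measure set T1 -> \bar R})
    (m2 : {sigma_finite_measure set T2 -> \bar R}) (f : T1 -> R) (g : T2 -> R) :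
  m1.-integrable [set: T1] (EFin \o f) -> m2.-integrable [set: T2] (EFin \o g) ->
  (m1 \x m2)%E.-integrable [set: T1 * T2] (fun p => (f p.1 * g p.2)%:E) /\
  (\int[m1 \x m2]_p (f p.1 * g p.2)%:E =
   (\int[m1]_x (f x)%:E) * (\int[m2]_x (g x)%:E))%E.
Proof.
move=> If Ig.
have mf : measurable_fun setT f by apply/measurable_EFinP; exact: measurable_int If.
have mg : measurable_fun setT g by apply/measurable_EFinP; exact: measurable_int Ig.
have I : (m1 \x m2)%E.-integrable [set: T1 * T2] (fun p => (f p.1 * g p.2)%:E).
  apply/integrable12ltyP.
    apply/measurable_EFinP/measurable_funM.
      exact: measurableT_comp.
    exact: measurableT_comp.
  have [_ lf] := integrableP _ _ _ If; have [_ lg] := integrableP _ _ _ Ig.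
  have cg : (\int[m2]_y `|(g y)%:E|)%E \is a fin_num.
    by rewrite ge0_fin_numE// integral_ge0.
  have E x : (\int[m2]_y `|(f (x, y).1 * g (x, y).2)%:E| =
      (`|f x|)%:E * \int[m2]_y `|(g y)%:E|)%E.
    rewrite -ge0_integralZl//; last first.
      by apply: measurableT_comp => //; exact/measurable_EFinP.
    by apply: eq_integral => y _; rewrite EFinM abseM.
  under eq_integral => x _ do rewrite E.
  rewrite ge0_integralZr//; last 2 first.
  - by apply/measurable_EFinP; exact: measurableT_comp.
  - exact: integral_ge0.
  apply: lte_mul_pinfty => //; first exact: integral_ge0.
  by rewrite ge0_fin_numE// integral_ge0.
split=> //; rewrite -integral12_prod_meas1// /fubini_F.
under eq_integral => x _.
  rewrite /=; under eq_integral do rewrite EFinM.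
  rewrite integralZl//; over.
rewrite -(fineK (integrable_fin_num measurableT Ig)).
by rewrite integralZr.
Qed.

(** Induction on the dimension: [lebesgue_Rn] is by construction a pushforward of a product measure
    along [cons_pair], and in dimension 0 a Dirac mass integrates the empty product to 1. *)
Lemma integral_prod_tnth (R : realType) (s : nat) (f : 'I_s -> R -> R) :
  (forall j, (@mu R).-integrable [set: R] (EFin \o f j)) ->
  (lebesgue_Rn R s).-integrable [set: Rn R s]
    (fun x => (\prod_(j < s) f j (tnth x j))%:E) /\
  \int[lebesgue_Rn R s]_x \prod_(j < s) f j (tnth x j) =
  \prod_(j < s) \int[mu]_t f j t.
Proof.
elim: s f => [|s IHs] f If.
  split.
    under eq_fun do rewrite big_ord0.
    apply/integrableP; split; first exact: measurable_cst.
    have := @integral_dirac _ (Rn R 0) [tuple] R setT measurableT _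
      (@measurable_cst _ _ (Rn R 0) (\bar R) setT `|1|%E).
    by rewrite diracT mul1e /= normr1 => ->; rewrite ltry.
  rewrite /Rintegral; under eq_integral do rewrite big_ord0.
  have := @integral_dirac _ (Rn R 0) [tuple] R setT measurableT _
    (@measurable_cst _ _ (Rn R 0) (\bar R) setT 1%E).
  by rewrite diracT mul1e /= => ->; rewrite big_ord0.
have mf j : measurable_fun [set: R] (f j).
  by apply/measurable_EFinP; exact: measurable_int (If j).
have [IG EG] := IHs (fun j => f (lift ord0 j)) (fun j => If (lift ord0 j)).
have [I E] := integrable_mul_prod_measure (If ord0) IG.
have mF : measurable_fun [set: Rn R s.+1]
    (fun x : Rn R s.+1 => (\prod_(j < s.+1) f j (tnth x j))%:E).
  by apply/measurable_EFinP; exact: measurable_prod_tnth.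
have If' : (mu \x lebesgue_Rn R s)%E.-integrable (@cons_pair R s @^-1` setT)
    ((fun x : Rn R s.+1 => (\prod_(j < s.+1) f j (tnth x j))%:E) \o @cons_pair R s).
  rewrite preimage_setT; apply: eq_integrable I => // p _ /=.
  by rewrite prod_tnth_cons_pair.
split.
  exact: (integrable_pushforward (@measurable_cons_pair R s) mF If' measurableT).
rewrite /Rintegral /= /lebesgue_cons.
rewrite (integral_pushforward (@measurable_cons_pair R s) mF If' measurableT).
rewrite preimage_setT; under eq_integral => p _ do rewrite /= prod_tnth_cons_pair.
have F0 := integrable_fin_num measurableT (If ord0).
have FG := integrable_fin_num measurableT IG.
by rewrite E (fineM F0 FG) big_ord_recl; congr (_ * _); exact: EG.
Qed.
Lemma sqrte_le (R : realType) (x : \bar R) (e : R) : (0 <= x)%E -> 0 <= e ->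
  (x `^ (2^-1) <= e%:E)%E = (x <= (e ^+ 2)%:E)%E.
Proof.
case: x => [r| |]; rewrite ?lee_fin => x0 e0; last by [].
  rewrite powR12_sqrt//.
  by rewrite -[in RHS](sqr_sqrtr x0) ler_pXn2r// nnegrE sqrtr_ge0.
by rewrite poweRyr// !leye_eq.
Qed.

Lemma sqrte_ge (R : realType) (x : \bar R) (e : R) : (0 <= x)%E -> 0 <= e ->
  (e%:E <= x `^ (2^-1))%E = ((e ^+ 2)%:E <= x)%E.
Proof.
case: x => [r| |]; rewrite ?lee_fin => x0 e0; last by [].
  rewrite powR12_sqrt//.
  by rewrite -[in RHS](sqr_sqrtr x0) ler_pXn2r// nnegrE sqrtr_ge0.
by rewrite poweRyr// !leey.
Qed.

Lemma sqrte_lty (R : realType) (x : \bar R) :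
  (x `^ (2^-1) < +oo)%E = (x < +oo)%E.
Proof.
apply/idP/idP; last exact: poweR_lty.
by apply: lty_poweRy; rewrite invr_neq0.
Qed.

Lemma sum_le_esum (R : realType) (I : choiceType) (F : seq I) (a : I -> \bar R) :
  uniq F -> (\sum_(k <- F) a k <= \esum_(k in [set: I]) a k)%E.
Proof.
move=> uF; apply: esum_ge; exists [set` F]; last by rewrite -fsbig_seq.
by split => //; exact: finite_seq.
Qed.

Lemma esum_finite_support (R : realType) (I : choiceType) (F : seq I)
    (a : I -> \bar R) :
  uniq F -> (forall k, 0 <= a k)%E -> (forall k, k \notin F -> a k = 0)%E ->
  (\esum_(k in [set: I]) a k = \sum_(k <- F) a k)%E.
Proof.
move=> uF a0 aF; rewrite fsbig_seq// -esum_fset; [|exact: finite_seq|by []].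
rewrite [RHS]esum_mkcond; apply: eq_esum => k _.
case: ifPn => // kF; apply: aF; move: kF; apply: contra => kF.
by rewrite inE.
Qed.

(** * Orthonormality and finite Hermite sums in L2 *)

Section hermite_system.
Context {R : realType} {s : nat}.
Local Notation nu := (lebesgue_Rn R s).
Local Notation Hm := (@Hermite R s).
Local Notation w := (@phis R s).
Implicit Types (f g : Rn R s -> R) (k l : s.-tuple nat) (F : seq (s.-tuple nat)).

Lemma measurable_Hermite k : measurable_fun [set: Rn R s] (Hm k).
Proof.
apply: (@measurable_prod_tnth _ _ (fun j => hermite (tnth k j))) => j.
exact: measurable_hermite.
Qed.

Lemma measurable_phis : measurable_fun [set: Rn R s] w.
Proof. by apply: (@measurable_prod_tnth _ _ (fun=> @phi R)) => j; exact: measurable_phi. Qed.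

Lemma phis_gt0 x : 0 < w x.
Proof. by apply: prodr_gt0 => j _; exact: phi_gt0. Qed.

Lemma phis_ge0 x : 0 <= w x. Proof. exact: ltW (phis_gt0 x). Qed.

Lemma Hermite_prodE k l x : Hm k x * Hm l x * w x =
  \prod_(j < s) (hermite (tnth k j) (tnth x j) * hermite (tnth l j) (tnth x j)
    * phi (tnth x j)).
Proof. by rewrite /Hermite /phis -!big_split. Qed.

Lemma integrable_HermiteM k l :
  nu.-integrable [set: Rn R s] (fun x => (Hm k x * Hm l x * w x)%:E).
Proof.
under eq_fun do rewrite Hermite_prodE.
apply: (@integral_prod_tnth R s
  (fun j t => hermite (tnth k j) t * hermite (tnth l j) t * phi t) _).1 => j.
exact: integrable_hermiteM.
Qed.

Lemma Hermite_orthonormal k l :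
  \int[nu]_x (Hm k x * Hm l x * w x) = (k == l)%:R.
Proof.
under eq_Rintegral do rewrite Hermite_prodE.
rewrite (@integral_prod_tnth R s
  (fun j t => hermite (tnth k j) t * hermite (tnth l j) t * phi t) _).2; last first.
  by move=> j; exact: integrable_hermiteM.
under eq_bigr do rewrite hermite_orthonormal.
rewrite eqEtuple; case: forallP => [H|H].
  by rewrite big1// => j _; rewrite (eqP (H j)) eqxx.
have /existsP[j kl] : [exists j, tnth k j != tnth l j].
  by rewrite -negb_forall; apply/forallP.
by rewrite (bigD1 j)//= (negbTE kl) mul0r.
Qed.

Lemma sqr_phis_ge0 f x : (0 <= (f x ^+ 2 * w x)%:E)%E.
Proof. by rewrite lee_fin mulr_ge0 ?sqr_ge0 ?phis_ge0. Qed.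

Lemma measurable_sqr_phis f : measurable_fun [set: Rn R s] f ->
  measurable_fun [set: Rn R s] (fun x => (f x ^+ 2 * w x)%:E).
Proof.
move=> mf; apply/measurable_EFinP/measurable_funM; last exact: measurable_phis.
exact: measurable_funX.
Qed.

Lemma L2P f : L2 f <-> measurable_fun [set: Rn R s] f /\
  nu.-integrable [set: Rn R s] (fun x => (f x ^+ 2 * w x)%:E).
Proof.
have E : (\int[nu]_x `|(f x ^+ 2 * w x)%:E| = \int[nu]_x (f x ^+ 2 * w x)%:E)%E.
  by apply: eq_integral => x _; rewrite gee0_abs ?sqr_phis_ge0.
rewrite /L2/= /L2norm sqrte_lty; split=> -[mf If]; split=> //.
  by apply/integrableP; split; [exact: measurable_sqr_phis|rewrite E].
by have /integrableP[_] := If; rewrite E.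
Qed.

(** Dominated through |f g| <= f^2 + g^2. *)
Lemma L2_integrableM f g : L2 f -> L2 g ->
  nu.-integrable [set: Rn R s] (fun x => (f x * g x * w x)%:E).
Proof.
move=> /L2P[mf If] /L2P[mg Ig].
have := integrableD measurableT If Ig; apply: le_integrable => //.
  apply/measurable_EFinP/measurable_funM; last exact: measurable_phis.
  exact: measurable_funM.
move=> x _ /=; rewrite lee_fin [leRHS]ger0_norm; last first.
  by rewrite addr_ge0// mulr_ge0 ?sqr_ge0 ?phis_ge0.
rewrite normrM (ger0_norm (phis_ge0 x)) -mulrDl ler_wpM2r ?phis_ge0//.
rewrite normrM -(real_normK (num_real (f x))) -(real_normK (num_real (g x))).
have := sqr_ge0 (`|f x| - `|g x|); have := sqr_ge0 (`|f x| + `|g x|); nra.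
Qed.

Lemma L2_lin (a : R) f g : L2 f -> L2 g -> L2 (fun x => a * f x + g x).
Proof.
move=> f2 g2; have /L2P[mf If] := f2; have /L2P[mg Ig] := g2; apply/L2P; split.
  by apply: measurable_funD => //; exact: measurable_funM.
have := integrableD measurableT (integrableZl measurableT (a ^+ 2) If)
  (integrableD measurableT (integrableZl measurableT (2 * a) (L2_integrableM f2 g2)) Ig).
by apply: eq_integrable => // x _ /=; congr EFin; ring.
Qed.

Lemma L2_Hermite k : L2 (Hm k).
Proof.
apply/L2P; split; first exact: measurable_Hermite.
by apply: eq_integrable (integrable_HermiteM k k) => // x _; rewrite expr2.
Qed.

Lemma L2_cst0 : L2 (cst 0 : Rn R s -> R).
Proof.
apply/L2P; split => //; under eq_fun do rewrite expr0n mul0r.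
exact: integrable0.
Qed.

Lemma L2_sum F (c : s.-tuple nat -> R) : L2 (fun x => \sum_(k <- F) c k * Hm k x).
Proof.
elim: F => [|k F IHF].
  by under eq_fun do rewrite big_nil; exact: L2_cst0.
by under eq_fun do rewrite big_cons; apply: L2_lin => //; exact: L2_Hermite.
Qed.

Lemma fhat_lin (a : R) f g k : L2 f -> L2 g ->
  fhat (fun x => a * f x + g x) k = a * fhat f k + fhat g k.
Proof.
move=> f2 g2; have kf := L2_integrableM f2 (L2_Hermite k).
have kg := L2_integrableM g2 (L2_Hermite k).
have kaf := integrableZl measurableT a kf.
rewrite /fhat -RintegralZl// -RintegralD//.
by apply: eq_Rintegral => x _; ring.
Qed.

Lemma fhat_sum F (c : s.-tuple nat -> R) k : uniq F ->
  fhat (fun x => \sum_(k <- F) c k * Hm k x) k = if k \in F then c k else 0.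
Proof.
elim: F => [|l F IHF] /=.
  move=> _; rewrite /fhat; under eq_Rintegral do rewrite big_nil !mul0r.
  by rewrite /Rintegral integral0.
move=> /andP[lF uF].
have -> : (fun x => \sum_(k <- l :: F) c k * Hm k x) =
    (fun x => c l * Hm l x + (\sum_(k <- F) c k * Hm k x)).
  by apply/funext => x; rewrite big_cons.
rewrite fhat_lin; [|exact: L2_Hermite|exact: L2_sum].
rewrite IHF// /fhat Hermite_orthonormal inE eq_sym.
case: eqVneq => [->|_]; rewrite /= ?mulr0 ?add0r//.
by rewrite mulr1 (negbTE lF) addr0.
Qed.

Lemma L2norm_sum F (c : s.-tuple nat -> R) : uniq F ->
  (\int[nu]_x ((\sum_(k <- F) c k * Hm k x) ^+ 2 * w x)%:E =
   (\sum_(k <- F) c k ^+ 2)%:E)%E.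
Proof.
pose f x := \sum_(k <- F) c k * Hm k x => uF.
have f2 : L2 f by exact: L2_sum.
have /L2P[_ If] := f2.
rewrite -[LHS]fineK ?integrable_fin_num//; congr EFin.
(* Only one of the two factors is taken apart: f stays fixed while G grows, because each c k with k
   in F is the Hermite coefficient of f. *)
suff H G : {subset G <= F} ->
    \int[nu]_x (f x * (\sum_(k <- G) c k * Hm k x) * w x) = \sum_(k <- G) c k ^+ 2.
  by rewrite -(H F)//; apply: eq_Rintegral => x _; rewrite expr2.
elim: G => [_|k G IHG GF].
  rewrite big_nil; under eq_Rintegral do rewrite big_nil mulr0 mul0r.
  by rewrite /Rintegral integral0.
have g2 := L2_sum G c.
rewrite big_cons -IHG; last by move=> l lG; apply: GF; rewrite inE lG orbT.
have ck : c k = fhat f k by rewrite fhat_sum// GF// mem_head.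
have kf := L2_integrableM f2 (L2_Hermite k).
have kcf := integrableZl measurableT (c k) kf.
have fg := L2_integrableM f2 g2.
rewrite expr2 {2}ck /fhat -RintegralZl// -RintegralD//.
by apply: eq_Rintegral => x _; rewrite big_cons; ring.
Qed.

End hermite_system.

(** * Minimal errors and information complexity *)

Section summation.
Context {I : countType}.
Implicit Types F : seq I.

Lemma sum_seq_support (V : nmodType) (A F : seq I) (a : I -> V) :
  uniq A -> uniq F -> {subset F <= A} ->
  (forall k, k \notin F -> a k = 0) -> \sum_(k <- A) a k = \sum_(k <- F) a k.
Proof.
move=> uA uF FA aF; rewrite (bigID (mem F))/= [X in _ + X]big1 ?addr0//.
rewrite -big_filter; apply: perm_big; apply: uniq_perm => //.
  exact: filter_uniq.
by move=> k; rewrite mem_filter; case: (boolP (k \in F)) => //= /FA.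
Qed.

(** A sequence of finite lists exhausting the complement of F, by the code numbers of a countable
    type. It replaces the directed family of finite sets by a sequence, as Fatou's lemma
    requires. *)
Definition enum_off (F : seq I) (n : nat) : seq I :=
  [seq k <- undup (pmap choice.unpickle (iota 0 n)) | k \notin F].

Lemma enum_off_uniq F n : uniq (enum_off F n).
Proof. by rewrite filter_uniq// undup_uniq. Qed.

Lemma enum_off_notin F n k : k \in enum_off F n -> k \notin F.
Proof. by rewrite mem_filter => /andP[]. Qed.

Lemma mem_enum_off F n k :
  (choice.pickle k < n)%N -> k \notin F -> k \in enum_off F n.
Proof.
move=> kn kF; rewrite mem_filter kF mem_undup mem_pmap.
by rewrite /=; apply/mapP; exists (choice.pickle k); rewrite ?mem_iota ?choice.pickleK.
Qed.

Lemma partial_sumE (V : zmodType) (a : I -> V) (A : {fset I}) :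
  summability.partial_sum a A = \sum_(k <- A) a k.
Proof. by rewrite /summability.partial_sum big_seq_fsetE. Qed.

Lemma cvg_sum_enum_off (R : realType) (a : I -> R) (l : R) F : uniq F ->
  summability.partial_sum a @ summability.totally --> l ->
  \sum_(k <- enum_off F n) a k @[n --> \oo] --> l - \sum_(k <- F) a k.
Proof.
move=> uF al; pose G n : {fset I} := seq_fset tt (F ++ enum_off F n).
have GE n : summability.partial_sum a (G n) =
    \sum_(k <- F) a k + \sum_(k <- enum_off F n) a k.
  rewrite partial_sumE -big_cat (perm_big _ (seq_fset_perm _ _)) undup_id//.
  rewrite cat_uniq uF enum_off_uniq andbT; apply/hasPn => k.
  exact: enum_off_notin.
(* [G n] eventually contains any finite set A, namely once n exceeds all codes of A. *)
have cG : G n @[n --> \oo] --> (@summability.totally I).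
  move=> P /= [A _ AP]; suff : \forall n \near \oo, P (G n) by [].
  near=> n; apply: AP => /=.
  apply/fsubsetP => k kA; rewrite seq_fsetE mem_cat.
  case: (boolP (k \in F)) => //= kF; apply: mem_enum_off => //.
  have : (choice.pickle k <= \max_(k <- A) choice.pickle k)%N.
    by rewrite (big_rem k)//= leq_maxl.
  move=> /leq_ltn_trans; apply; near: n; exact: nbhs_infty_gt.
have -> : (fun n => \sum_(k <- enum_off F n) a k) =
    (fun n => summability.partial_sum a (G n) - \sum_(k <- F) a k).
  by apply/funext => n; rewrite GE addrAC subrr add0r.
apply: cvgB; last exact: cvg_cst.
exact: cvg_comp cG al.
Unshelve. all: by end_near. Qed.

End summation.

(** * Error bounds in the weighted Hermite space *)

Section weighted_space.
Context {R : realType} (alpha : R) (gamma : nat -> R) {s : nat}.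
Hypotheses (alpha_ge1 : 1 <= alpha) (gamma_gt0 : forall j, 0 < gamma j).
Local Notation nu := (lebesgue_Rn R s).
Local Notation Hm := (@Hermite R s).
Local Notation w := (@phis R s).
Local Notation r := (@fweights R alpha gamma s).
Implicit Types (f g : Rn R s -> R) (k l : s.-tuple nat) (F : seq (s.-tuple nat)).

Lemma fweight_pos (g : R) (k : nat) : 0 < g -> 0 < fweight alpha g k.
Proof.
case: k => [|k] g0; first by rewrite /fweight.
by rewrite fweightE// mulr_gt0// fweight_gt0.
Qed.

Lemma fweights_gt0 k : 0 < r k.
Proof. by apply: prodr_gt0 => j _; exact: fweight_pos. Qed.

Lemma Hnorm_term_ge0 f k : (0 <= ((r k)^-1 * fhat f k ^+ 2)%:E)%E.
Proof. by rewrite lee_fin mulr_ge0 ?sqr_ge0// invr_ge0 ltW// fweights_gt0. Qed.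

Lemma sum_fhat_le F f (e : R) : uniq F -> 0 <= e ->
  (Hnorm alpha gamma f <= e%:E)%E ->
  \sum_(k <- F) (r k)^-1 * fhat f k ^+ 2 <= e ^+ 2.
Proof.
move=> uF e0; rewrite sqrte_le//; last by apply: esum_ge0 => k _; exact: Hnorm_term_ge0.
by move=> /(le_trans (sum_le_esum _ uF)); rewrite sumEFin lee_fin.
Qed.

Lemma Hnorm_sum F (c : s.-tuple nat -> R) : uniq F ->
  Hnorm alpha gamma (fun x => \sum_(k <- F) c k * Hm k x) =
  ((\sum_(k <- F) (r k)^-1 * c k ^+ 2)%:E `^ (2^-1))%E.
Proof.
move=> uF; rewrite /Hnorm (esum_finite_support uF).
- rewrite sumEFin; congr (_%:E `^ _)%E; apply: eq_big_seq => k kF.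
  by rewrite fhat_sum// kF.
- by move=> k; exact: Hnorm_term_ge0.
- by move=> k kF; rewrite fhat_sum// (negbTE kF) expr0n mulr0.
Qed.

(** The coefficients vanish off F, so the partial sums are constant on all finite sets containing
    F. *)
Lemma Hspace_sum F (c : s.-tuple nat -> R) : uniq F ->
  Hspace alpha gamma (fun x => \sum_(k <- F) c k * Hm k x).
Proof.
move=> uF; split; [exact: L2_sum|by rewrite Hnorm_sum// poweR_lty// ltry|].
move=> x; apply: cvg_near_cst; first exact: summability.totally_filter.
pose S : {fset s.-tuple nat} := seq_fset tt F.
exists S => // A /= FA.
rewrite partial_sumE (@sum_seq_support _ _ A F)//.
- by apply: eq_big_seq => k kF; rewrite fhat_sum// kF.
- exact: fset_uniq.
- by move=> k kF; apply: (fsubsetP FA); rewrite seq_fsetE.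
- by move=> k kF; rewrite fhat_sum// (negbTE kF) mul0r.
Qed.

Lemma fhat_Lambda_all k : Lambda_all alpha gamma (fun f => fhat f k).
Proof.
split=> [a f g [f2 _ _] [g2 _ _]|f [f2 _ _] e e0]; first exact: fhat_lin.
have r0 := fweights_gt0 k.
have sr0 : 0 < Num.sqrt (r k) by rewrite sqrtr_gt0.
(* A norm bound d controls the k-th coefficient by d sqrt (r k), non-strictly; halving e restores
   the strict inequality. *)
exists (e / 2 / Num.sqrt (r k)); first by rewrite !divr_gt0.
move=> g [g2 _ _] /ltW H.
have E : fhat (fun x => g x - f x) k = fhat g k - fhat f k.
  have -> : (fun x => g x - f x) = (fun x => -1 * f x + g x).
    by apply/funext => x; ring.
  by rewrite fhat_lin//; ring.
have d0 : 0 <= e / 2 / Num.sqrt (r k) by rewrite ltW// !divr_gt0.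
have := @sum_fhat_le [:: k] _ _ isT d0 H.
rewrite big_seq1 E expr_div_n sqr_sqrtr ?(ltW r0)// mulrC ler_pM2r ?invr_gt0//.
have h0 : 0 <= e / 2 by rewrite divr_ge0// ltW.
rewrite -[in X in X <= _](real_normK (num_real _)) ler_pXn2r//.
by move=> /le_lt_trans; apply; rewrite ltr_pdivrMr// ltr_pMr// ltr1n.
Qed.

(* Fatou's lemma along the pointwise convergent partial sums replaces the
   completeness of the Hermite system. *)
Lemma Hspace_truncation_error F (eps : R) f : uniq F -> 0 <= eps ->
  (forall k, k \notin F -> r k <= eps ^+ 2) ->
  Hspace alpha gamma f -> (Hnorm alpha gamma f <= 1)%E ->
  (L2norm (fun x => f x - \sum_(k <- F) fhat f k * Hm k x)%R <= eps%:E)%E.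
Proof.
move=> uF e0 rF [f2 _ cf] f1.
rewrite sqrte_le//; last first.
  by apply: integral_ge0 => x _; rewrite lee_fin mulr_ge0 ?sqr_ge0 ?phis_ge0.
pose u n x := \sum_(k <- enum_off F n) fhat f k * Hm k x.
have mu_ n := measurable_sqr_phis (proj1 (L2_sum (enum_off F n) (fhat f))).
(* The remainder of the truncation is the pointwise limit of the sums [u n] over indices outside F,
   so its square is a lower limit. *)
have -> : (\int[nu]_x ((f x - \sum_(k <- F) fhat f k * Hm k x) ^+ 2 * w x)%:E =
    \int[nu]_x limn_einf (fun n => (u n x ^+ 2 * w x)%:E))%E.
  apply: eq_integral => x _.
  have : (u n x ^+ 2 * w x)%:E @[n --> \oo] -->
      ((f x - \sum_(k <- F) fhat f k * Hm k x) ^+ 2 * w x)%:E.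
    apply: cvg_EFin; first exact: nearW.
    apply: cvgMr_tmp; rewrite /=; apply: (@cvg_comp _ _ _ _ (fun t => t ^+ 2)); last first.
      exact: exprn_continuous.
    exact: cvg_sum_enum_off (cf x).
  by move=> H; rewrite (cvg_limn_einf_sup H).1.
apply: le_trans (fatou _ measurableT mu_ _) _.
  by move=> n x _; rewrite lee_fin mulr_ge0 ?sqr_ge0 ?phis_ge0.
rewrite limn_einf_lim.
apply: lime_le; first by apply: is_cvg_einfs.
apply: nearW => n; apply: ge_ereal_inf.
eexists; first by exists n => /=.
rewrite L2norm_sum ?enum_off_uniq// lee_fin.
have := @sum_fhat_le (enum_off F n) f 1 (enum_off_uniq F n) ler01 f1.
rewrite expr1n => H; rewrite -[leRHS]mulr1.
(* Outside F each squared coefficient is at most eps^2 times its contribution to the squared norm,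
   which totals at most 1. *)
apply: le_trans (ler_wpM2l (sqr_ge0 eps) H); rewrite mulr_sumr.
rewrite big_seq [leRHS]big_seq; apply: ler_sum => k /enum_off_notin kF.
rewrite mulrA ler_peMl ?sqr_ge0// ler_pdivlMr ?fweights_gt0// mul1r.
exact: rF.
Qed.

Lemma min_error_le F (eps : R) : uniq F -> 0 <= eps ->
  (forall k, k \notin F -> r k <= eps ^+ 2) ->
  (min_error alpha gamma (size F) s <= eps%:E)%E.
Proof.
move=> uF e0 rF; pose t := in_tuple F.
apply: (@le_trans _ _ (wc_error alpha gamma
  (algorithm (fun i f => fhat f (tnth t i)) (fun i => Hm (tnth t i))))).
  apply: ereal_inf_lbound.
  exists (fun i f => fhat f (tnth t i)), (fun i => Hm (tnth t i)).
  split=> // i; [exact: fhat_Lambda_all|exact: L2_Hermite].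
apply: ge_ereal_sup => _ /= [f [fH f1] <-].
apply: le_trans (Hspace_truncation_error uF e0 rF fH f1).
rewrite le_eqVlt; apply/orP; left; apply/eqP; congr L2norm.
by apply/funext => x; rewrite /algorithm [in RHS](big_tnth _ _ F).
Qed.

Lemma info_complexity_le F (eps : R) : uniq F -> 0 <= eps ->
  (forall k, k \notin F -> r k <= eps ^+ 2) ->
  (info_complexity alpha gamma eps s <= (size F)%:R%:E)%E.
Proof.
move=> uF e0 rF; apply: ereal_inf_lbound; exists (size F) => //=.
exact: min_error_le.
Qed.

Lemma Lambda_all_sum (L : (Rn R s -> R) -> R) F (c : s.-tuple nat -> R) :
  Lambda_all alpha gamma L -> uniq F ->
  L (fun x => \sum_(k <- F) c k * Hm k x) = \sum_(k <- F) c k * L (Hm k).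
Proof.
move=> [Llin _].
have H1 k : Hspace alpha gamma (Hm k).
  have := @Hspace_sum [:: k] (fun=> 1) isT.
  by under eq_fun do rewrite big_seq1 mul1r.
have H0 : Hspace alpha gamma (cst 0 : Rn R s -> R).
  have := @Hspace_sum [::] (fun=> 1) isT.
  by under eq_fun do rewrite big_nil.
have L0 : L (cst 0) = 0.
  have := Llin 1 _ _ H0 H0; rewrite mul1r.
  have -> : (fun x : Rn R s => 1 * cst 0 x + cst 0 x) = cst 0 :> (Rn R s -> R).
    by apply/funext => x; rewrite /cst mulr0 addr0.
  by move=> /eqP; rewrite -subr_eq0 opprD addrA subrr add0r oppr_eq0 => /eqP.
elim: F => [_|k F IHF /= /andP[kF uF]].
  by under eq_fun do rewrite big_nil; rewrite big_nil.
under eq_fun do rewrite big_cons.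
by rewrite Llin// ?IHF ?big_cons//; exact: Hspace_sum.
Qed.

(** The matrix of values L_j (H_k) has more rows than columns, hence a nonzero row vector in its
    left kernel; [c] carries this vector from positions in F to multi-indices. *)
Lemma exists_kernel_sum F (n : nat) (L : 'I_n -> (Rn R s -> R) -> R) :
  uniq F -> (n < size F)%N -> (forall i, Lambda_all alpha gamma (L i)) ->
  exists c : s.-tuple nat -> R,
    [/\ forall i, L i (fun x => \sum_(k <- F) c k * Hm k x) = 0 &
        exists2 k, k \in F & c k != 0].
Proof.
move=> uF nF LA; pose t := in_tuple F.
pose M : 'M[R]_(size F, n) := \matrix_(i, j) L j (Hm (tnth t i)).
have : kermx M != 0.
  rewrite kermx_eq0; apply/negP => /eqP rM.
  by have := rank_leq_col M; rewrite rM leqNgt nF.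
move=> /rowV0Pn[v /sub_kermxP vM v0].
pose c k := \sum_(i < size F | tnth t i == k) v 0 i.
have ct i : c (tnth t i) = v 0 i.
  rewrite /c (big_pred1 i)// => j; rewrite /= (inj_eq _)//.
  exact/tuple_uniqP.
exists c; split=> [j|].
  rewrite Lambda_all_sum// big_tnth.
  have /matrixP/(_ 0 j) := vM; rewrite !mxE => vj.
  by rewrite -[RHS]vj; apply: eq_bigr => i _; rewrite mxE -/t ct.
have [i vi] : exists i, v 0 i != 0 by apply/rV0Pn.
by exists (tnth t i); [exact: mem_tnth|rewrite ct].
Qed.

(** A function of norm 1 in the common kernel of the functionals is sent to 0 by the algorithm, so
    its L2 norm is a lower bound for the error, and that norm is at least d because every weight on
    F is at least d^2. *)
Lemma min_error_ge F (n : nat) (d : R) : uniq F -> 0 <= d ->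
  (forall k, k \in F -> d ^+ 2 <= r k) -> (n < size F)%N ->
  (d%:E <= min_error alpha gamma n s)%E.
Proof.
move=> uF d0 dF nF; apply: le_ereal_inf_tmp => _ [L [g [LA _ ->]]].
have [c [Lc [k0 k0F ck0]]] := exists_kernel_sum uF nF LA.
pose q := \sum_(k <- F) (r k)^-1 * c k ^+ 2.
have term0 k : 0 <= (r k)^-1 * c k ^+ 2.
  by rewrite mulr_ge0 ?sqr_ge0// invr_ge0 ltW// fweights_gt0.
have q0 : 0 < q.
  rewrite /q (big_rem k0)//= ltr_wpDr//; first by apply: sumr_ge0.
  by rewrite mulr_gt0 ?invr_gt0 ?fweights_gt0// exprn_even_gt0//= ck0.
pose c' k := (Num.sqrt q)^-1 * c k.
have Lc' i : L i (fun x => \sum_(k <- F) c' k * Hm k x) = 0.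
  rewrite Lambda_all_sum//; have := Lc i; rewrite Lambda_all_sum// => E.
  under eq_bigr do rewrite /c' -mulrA.
  by rewrite -mulr_sumr E mulr0.
have sq : \sum_(k <- F) (r k)^-1 * c' k ^+ 2 = 1.
  under eq_bigr do rewrite exprMn mulrCA.
  rewrite -mulr_sumr -/q exprVn sqr_sqrtr ?(ltW q0)// mulVf//.
  by rewrite gt_eqF.
pose f x := \sum_(k <- F) c' k * Hm k x.
apply: (@le_trans _ _ (L2norm (fun x => f x - algorithm L g f x))); last first.
  apply: ereal_sup_ubound; exists f => //; split; first exact: Hspace_sum.
  by rewrite Hnorm_sum// sq poweR1r.
have -> : (fun x => f x - algorithm L g f x) = f.
  apply/funext => x; rewrite /algorithm big1 ?subr0// => i _.
  by rewrite Lc' mul0r.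
rewrite sqrte_ge//; last first.
  by apply: integral_ge0 => x _; rewrite lee_fin mulr_ge0 ?sqr_ge0 ?phis_ge0.
rewrite L2norm_sum// lee_fin -[leLHS]mulr1 -sq mulr_sumr.
rewrite big_seq [leRHS]big_seq; apply: ler_sum => k kF.
rewrite mulrA ler_piMl ?sqr_ge0// ler_pdivrMr ?fweights_gt0// mul1r.
exact: dF.
Qed.

Lemma info_complexity_ge F (eps : R) : uniq F -> 0 <= eps ->
  (forall k, k \in F -> eps ^+ 2 < r k) ->
  ((size F)%:R%:E <= info_complexity alpha gamma eps s)%E.
Proof.
move=> uF e0 rF.
(* The minimal error is an infimum, so it must be kept away from eps by a gap; finiteness of F
   supplies one. *)
have [d ed dF] : exists2 d, eps < d & forall k, k \in F -> d ^+ 2 <= r k.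
  elim: F {uF} rF => [_|k F IHF rF]; first by exists (eps + 1); rewrite ?ltrDl.
  have [d ed dF] := IHF (fun l lF => rF l (mem_behead (s := k :: F) lF)).
  have rk0 := ltW (fweights_gt0 k).
  have ek : eps < Num.sqrt (r k).
    by rewrite -(ger0_norm e0) -sqrtr_sqr ltr_sqrt ?fweights_gt0// rF// mem_head.
  exists (Num.min d (Num.sqrt (r k))); first by rewrite lt_min ed.
  have m0 : 0 <= Num.min d (Num.sqrt (r k)).
    by rewrite le_min sqrtr_ge0 andbT (le_trans e0)// ltW.
  have d0 : 0 <= d := le_trans e0 (ltW ed).
  move=> l; rewrite inE => /predU1P[->|/dF]; last first.
    by apply: le_trans; rewrite ler_pXn2r// ge_min lexx.
  by rewrite -[leRHS](sqr_sqrtr rk0) ler_pXn2r ?nnegrE// ge_min lexx orbT.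
apply: le_ereal_inf_tmp => _ /= [n nE <-]; rewrite lee_fin ler_nat leqNgt.
apply/negP => nF; have := min_error_ge uF (le_trans e0 (ltW ed)) dF nF.
by move=> /le_trans/(_ nE); rewrite lee_fin leNgt ed.
Qed.

End weighted_space.

(** * Counting multi-indices *)

Section real_lemmas.
Context {R : realType}.

Lemma powR_prod (I : Type) (F : seq I) (P : pred I) (x : I -> R) (p : R) :
  (forall i, P i -> 0 <= x i) ->
  (\prod_(i <- F | P i) x i) `^ p = \prod_(i <- F | P i) x i `^ p.
Proof.
move=> x0; elim: F => [|i F IHF]; first by rewrite !big_nil powR1.
rewrite !big_cons; case: ifPn => // Pi.
by rewrite powRM ?x0// ?IHF//; exact: prodr_ge0.
Qed.

(** A discrete integral test: the induction carries the antiderivative of x^(-q) as a correction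
    term, so that the sum telescopes. *)
Lemma sum_powR_le (q : R) (N : nat) : 1 < q ->
  \sum_(i < N) i.+1%:R `^ (- q) <= 1 + (q - 1)^-1.
Proof.
move=> q1; have d0 : 0 < q - 1 by rewrite subr_gt0.
suff H n : \sum_(i < n.+1) i.+1%:R `^ (- q) <=
    1 + (q - 1)^-1 * (1 - n.+1%:R `^ (- (q - 1))).
  case: N => [|n]; first by rewrite big_ord0 addr_ge0// invr_ge0 ltW.
  apply: le_trans (H n) _; rewrite lerD2l ler_piMr ?invr_ge0 ?(ltW d0)//.
elim: n => [|n IHn]; first by rewrite big_ord1 powR1 subrr mulr0 addr0.
rewrite big_ord_recr/=; set m := n.+2%:R : R.
have m1 : 1 < m by rewrite ltr1n.
have m0 : 0 < m := lt_trans ltr01 m1.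
have := powR_pred_le (ltW d0) m1.
have -> : m - 1 = n.+1%:R by rewrite /m -natr1 addrK.
set t := n.+1%:R : R in IHn *; have t0 : 0 < t by [].
move=> H.
have -> : m `^ (- q) = m^-1 * m `^ (- (q - 1)).
  rewrite -(powR_inv1 (ltW m0)) -powRD; first by congr (_ `^ _); ring.
  by rewrite (gt_eqF m0) implybT.
(* Divided by q - 1, the excess of the right side over m^(-(q-1)) is at least m^(-q), the term just
   added. *)
have : (1 + (q - 1) / m) * m `^ (- (q - 1)) <= t `^ (- (q - 1)).
  rewrite !powRN ler_pdivrMr ?powR_gt0// ler_pdivlMl ?powR_gt0//.
  apply: le_trans (ler_wpM2l (powR_ge0 _ _) (expR_ge1Dx _)) _.
  rewrite mulrC; apply: le_trans (ler_wpM2l (expR_ge0 _) H) _.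
  by rewrite mulrA -expRD addrN expR0 mul1r.
move: IHn; set A := \sum_(i < _) _; set X := t `^ _; set Y := m `^ _ => IHn K.
have : (q - 1)^-1 * ((1 + (q - 1) / m) * Y) <= (q - 1)^-1 * X.
  by rewrite ler_wpM2l// invr_ge0 ltW.
have -> : (q - 1)^-1 * ((1 + (q - 1) / m) * Y) = (q - 1)^-1 * Y + m^-1 * Y.
  by field; rewrite !gt_eqF.
move: IHn; rewrite !mulrBr mulr1.
set p1 := _ * X; set p2 := _ * Y; set p3 := _ * Y; lra.
Qed.

Lemma powR_unbounded (a K : R) : 0 < a ->
  exists N : nat, forall n, (N <= n)%N -> K < n%:R `^ a.
Proof.
move=> a0; pose x := `|K| `^ a^-1.
exists (Num.bound x) => n xn; apply: le_lt_trans (ler_norm K) _.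
have -> : `|K| = x `^ a by rewrite -powRrM mulVf ?gt_eqF// powRr1.
apply: gt0_ltr_powR; rewrite ?nnegrE ?powR_ge0//.
by apply: lt_le_trans (archi_boundP (powR_ge0 _ _)) _; rewrite ler_nat.
Qed.

(** Otherwise n^(a - b) would be bounded by K. The lemma turns asymptotic bounds on the complexity
    into inequalities between exponents. *)
Lemma powR_le_exponent (a b K : R) (N : nat) :
  (forall n, (N <= n)%N -> n%:R `^ a <= K * n%:R `^ b) -> a <= b.
Proof.
move=> H; rewrite leNgt; apply/negP => ba.
have d0 : 0 < a - b by rewrite subr_gt0.
have [M HM] := powR_unbounded K d0.
have n0 : ((maxn N M).+1%:R : R) != 0 by rewrite pnatr_eq0.
have := H (maxn N M).+1 (leqW (leq_maxl _ _)).
have := HM (maxn N M).+1 (leqW (leq_maxr _ _)).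
rewrite powRB ?n0 ?implybT// ltr_pdivlMr ?powR_gt0 ?ltr0n// => /lt_le_trans h /h.
by rewrite ltxx.
Qed.

(** Each of the m factors of the falling factorial is at least s - m >= s / 2. *)
Lemma binomial_lower_bound (m s : nat) : (m.*2 <= s)%N ->
  (s%:R / 2) ^+ m <= m`!%:R * 'C(s, m)%:R :> R.
Proof.
move=> ms; rewrite -natrM mulnC bin_ffact.
have H j : (j <= m)%N -> ((s - m) ^ j <= s ^_ j)%N.
  elim: j => [//|j IHj] jm; rewrite expnSr ffactnSr.
  by apply: leq_mul; [exact: IHj (ltnW jm)|apply: leq_sub2l; exact: ltnW].
apply: (@le_trans _ _ (((s - m) ^ m)%N%:R)); last by rewrite ler_nat H.
rewrite natrX lerXn2r ?nnegrE ?divr_ge0//.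
have ms' : (m <= s)%N by rewrite (leq_trans _ ms)// -addnn leq_addr.
rewrite natrB//; have : (m.*2%:R : R) <= s%:R by rewrite ler_nat.
by rewrite -muln2 natrM; lra.
Qed.

Lemma ler1D_ln (a x : R) : 0 < a -> 1 <= x -> 1 + ln x <= (1 + a^-1) * x `^ a.
Proof.
move=> a0 x1; have x0 : 0 < x := lt_le_trans ltr01 x1.
have X1 : 1 <= x `^ a by rewrite -[leLHS](powRr0 x) ler_powR// ltW.
have : a * ln x <= x `^ a by rewrite -ln_powR; apply/ltW/ln_sublinear/powR_gt0.
rewrite -ler_pdivlMl// mulrDl mul1r; lra.
Qed.

End real_lemmas.

(** * Upper and lower bounds on the complexity from the weights *)

Section complexity_bounds.
Context {R : realType} (alpha : R) (gamma : nat -> R).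
Hypotheses (alpha_ge1 : 1 <= alpha) (gamma_gt0 : forall j, 0 < gamma j)
  (gamma_le1 : forall j, gamma j <= 1).
Local Notation b := (fweight alpha 1).
Local Notation n := (info_complexity alpha gamma).

Lemma fweight_powR_sum (p : R) : alpha^-1 < p ->
  exists2 S : R, 0 <= S & forall N, \sum_(i < N) b i.+1 `^ p <= S.
Proof.
move=> pa; have a0 : 0 < alpha := lt_le_trans ltr01 alpha_ge1.
have p0 : 0 < p by apply: lt_trans pa; rewrite invr_gt0.
have q1 : 1 < alpha * p by rewrite -ltr_pdivrMl// mulr1.
have [C C0 HC] := fweight_ub alpha_ge1.
exists (C `^ p * (1 + (alpha * p - 1)^-1)).
  by rewrite mulr_ge0 ?powR_ge0// addr_ge0// invr_ge0 subr_ge0 ltW.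
move=> N; apply: le_trans (ler_wpM2l (powR_ge0 C p) (sum_powR_le N q1)).
rewrite mulr_sumr; apply: ler_sum => i _.
rewrite -mulNr powRrM -powRM ?powR_ge0 ?(ltW C0)//.
apply: ge0_ler_powR; rewrite ?nnegrE ?(ltW p0) ?(ltW (fweight_gt0 _ _))//.
  by rewrite mulr_ge0 ?powR_ge0 ?(ltW C0).
exact: HC.
Qed.

(** Since the weights are at most 1, raising the exponent only lowers the sum. One constant S thus
    serves exponents P that grow with the dimension. *)
Lemma sum_powR_fweight_le (p P S : R) (N : nat) : p <= P ->
  (forall N, \sum_(i < N) b i.+1 `^ p <= S) -> \sum_(i < N) b i.+1 `^ P <= S.
Proof.
move=> pP HS; apply: le_trans (HS N); apply: ler_sum => i _.
by apply: ger_powR; rewrite ?fweight_gt0// fweight_le1.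
Qed.

Lemma fweight_gamma_le1 (j k : nat) : fweight alpha (gamma j) k <= 1.
Proof.
case: k => [|k]; first by rewrite /fweight.
rewrite fweightE// -[leRHS]mulr1 ler_pM ?(ltW (gamma_gt0 _)) ?fweight_le1//.
exact/ltW/fweight_gt0.
Qed.

(** All other factors are at most 1. Consequently the multi-indices of large weight lie in a finite
    box. *)
Lemma fweights_le_coord (s : nat) (k : s.-tuple nat) (j : 'I_s) : 
  fweights alpha gamma k <= b (tnth k j).
Proof.
rewrite /fweights (bigD1 j)//= -[leRHS]mulr1; apply: ler_pM.
- exact/ltW/fweight_pos.
- by apply: prodr_ge0 => i _; exact/ltW/fweight_pos.
- case: (tnth k j) => [|m]; first by rewrite /fweight.
  by rewrite fweightE// ler_piMl// ltW// fweight_gt0.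
- apply: prodr_ile1 => i _; rewrite fweight_gamma_le1 andbT.
  exact/ltW/fweight_pos.
Qed.

Lemma exists_fweight_le (e : R) : 0 < e ->
  exists N, forall k, (N <= k)%N -> b k <= e.
Proof.
move=> e0; have a0 : 0 < alpha := lt_le_trans ltr01 alpha_ge1.
have [C C0 HC] := fweight_ub alpha_ge1.
have [N HN] := powR_unbounded (C / e) a0.
exists N.+1 => k Nk; have k0 : (0 < k)%N by case: k Nk.
apply: le_trans (HC _ k0) _; rewrite powRN ler_pdivrMr ?powR_gt0 ?ltr0n//.
by rewrite mulrC -ler_pdivrMr// ltW// HN// ltnW.
Qed.

Lemma info_complexity_ub (p S eps : R) (s : nat) : 0 < p -> 0 < eps ->
  (forall N, \sum_(i < N) b i.+1 `^ p <= S) ->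
  (n eps s <= (eps `^ (- (2 * p)) * expR (S * \sum_(j < s) gamma j `^ p))%:E)%E.
Proof.
move=> p0 e0 HS; have e20 : 0 < eps ^+ 2 by rewrite exprn_gt0.
have [N HN] := exists_fweight_le e20.
pose K (h : {ffun 'I_s -> 'I_N.+1}) : s.-tuple nat := [tuple val (h j) | j < s].
have Kinj : injective K.
  move=> h h' /(congr1 (fun t => tnth t)) E; apply/ffunP => j.
  by apply: val_inj; have := congr1 (@^~ j) E; rewrite !tnth_mktuple.
pose F := [seq k <- map K (enum {: {ffun 'I_s -> 'I_N.+1}}) |
           eps ^+ 2 < fweights alpha gamma k].
have uF : uniq F by rewrite filter_uniq// map_inj_uniq// enum_uniq.
have FN k : k \notin F -> fweights alpha gamma k <= eps ^+ 2.
  rewrite mem_filter negb_and -leNgt => /orP[//|kK].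
  case: (pselect (exists j, (N < tnth k j)%N)) => [[j kj]|/forallNP kN].
    exact: le_trans (fweights_le_coord k j) (HN _ (ltnW kj)).
  have kN' j : (tnth k j < N.+1)%N by rewrite ltnS leqNgt; apply/negP.
  case/negP: kK; apply/mapP; exists [ffun j => Ordinal (kN' j)].
    by rewrite mem_enum.
  by apply: eq_from_tnth => j; rewrite tnth_mktuple ffunE.
apply: le_trans (info_complexity_le alpha_ge1 gamma_gt0 uF (ltW e0) FN) _.
rewrite lee_fin -sum1_size natr_sum.
have r0 (k : s.-tuple nat) : 0 <= fweights alpha gamma k.
  exact/ltW/(fweights_gt0 alpha_ge1 gamma_gt0).
(* Every k in F has a ratio above 1 and so contributes at least 1; the sum is then extended to the
   whole box. *)
apply: (@le_trans _ _ (\sum_(k <- F) (fweights alpha gamma k / eps ^+ 2) `^ p)).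
  rewrite big_seq [leRHS]big_seq; apply: ler_sum => k.
  rewrite mem_filter => /andP[kF _].
  rewrite -[leLHS](powRr0 (fweights alpha gamma k / eps ^+ 2)).
  by rewrite ler_powR ?(ltW p0)// ler_pdivlMr// mul1r ltW.
apply: (@le_trans _ _ (\sum_(h : {ffun 'I_s -> 'I_N.+1})
    (fweights alpha gamma (K h) / eps ^+ 2) `^ p)).
  rewrite big_filter big_mkcond big_map big_enum; apply: ler_sum => h _.
  by case: ifP => // _; exact: powR_ge0.
have -> : \sum_(h : {ffun 'I_s -> 'I_N.+1})
    (fweights alpha gamma (K h) / eps ^+ 2) `^ p =
    eps `^ (- (2 * p)) * \prod_(j < s) \sum_(i < N.+1) fweight alpha (gamma j) i `^ p.
  rewrite bigA_distr_bigA mulr_sumr; apply: eq_bigr => h _.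
  rewrite powRM ?invr_ge0 ?(ltW e20)// mulrC; congr (_ * _).
    rewrite -powR_inv1 ?(ltW e20)// -powR_mulrn ?(ltW e0)// -!powRrM.
    by congr (_ `^ _); ring.
  rewrite powR_prod; last by move=> j _; exact/ltW/fweight_pos.
  by apply: eq_bigr => j _; rewrite tnth_mktuple.
(* Each one-dimensional sum is 1, from the entry 0, plus at most S gamma_j^p, and 1 + x <= exp x. *)
rewrite ler_wpM2l ?powR_ge0// mulr_sumr expR_sum; apply: ler_prod => j _.
rewrite sumr_ge0/=; last by move=> i _; exact: powR_ge0.
rewrite big_ord_recl {1}/fweight eqxx powR1.
apply: le_trans (expR_ge1Dx _); rewrite lerD2l.
under eq_bigr do rewrite lift0 fweightE// powRM ?(ltW (gamma_gt0 _)) ?(ltW (fweight_gt0 _ _))//.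
by rewrite -mulr_sumr mulrC ler_wpM2r ?powR_ge0.
Qed.

(** The indicator tuple of B has weight exactly the product of gamma_j over B, because [fweight] is
    1 at 0 and gamma_j at 1. *)
Lemma info_complexity_lb_sets (s : nat) (eps : R) (A : {set {set 'I_s}}) :
  0 <= eps -> (forall B : {set 'I_s}, B \in A -> eps ^+ 2 < \prod_(j in B) gamma j) ->
  (#|A|%:R%:E <= n eps s)%E.
Proof.
move=> e0 HA.
pose K (B : {set 'I_s}) : s.-tuple nat := [tuple nat_of_bool (j \in B) | j < s].
have Kinj : injective K.
  move=> B B' E; apply/setP => j; have := congr1 (fun t => tnth t j) E.
  by rewrite !tnth_mktuple; do 2! case: (j \in _).
have uF : uniq (map K (enum A)) by rewrite map_inj_uniq// enum_uniq.
rewrite cardE -(size_map K); apply: (info_complexity_ge alpha_ge1 gamma_gt0 uF e0).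
move=> _ /mapP[B BA ->]; rewrite mem_enum in BA.
rewrite /fweights; apply: lt_le_trans (HA B BA) _.
rewrite big_mkcond; apply: ler_prod => j _; rewrite tnth_mktuple.
have E1 : fweight alpha (gamma j) 1 = gamma j.
  by rewrite (fweightE _ _ (ltnSn 0)) (fweight1 alpha_ge1) mulr1.
have E0 : fweight alpha (gamma j) 0 = 1 by rewrite /fweight eqxx.
case: (j \in B); first by rewrite -[nat_of_bool true]/1%N E1 lexx ltW.
by rewrite -[nat_of_bool false]/0%N E0 lexx ler01.
Qed.

Lemma info_complexity_lb_dim1 (eps : R) (N : nat) : 0 <= eps ->
  (forall k, (0 < k <= N)%N -> eps ^+ 2 < gamma 0 * b k) ->
  (N%:R%:E <= n eps 1)%E.
Proof.
move=> e0 HN; pose K (i : nat) : 1.-tuple nat := [tuple i].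
have Kinj : injective K by move=> i j /(congr1 (fun t => tnth t ord0)).
have uF : uniq (map K (iota 1 N)) by rewrite map_inj_uniq// iota_uniq.
have -> : N = size (map K (iota 1 N)) by rewrite size_map size_iota.
apply: (info_complexity_ge alpha_ge1 gamma_gt0 uF e0).
move=> _ /mapP[i iN ->]; rewrite /fweights big_ord1 /=.
move: iN; rewrite mem_iota add1n ltnS => iN; rewrite fweightE ?HN//.
by case/andP: iN.
Qed.

End complexity_bounds.

(** * Tractability *)

Section tractability.
Context {R : realType} (alpha : R) (gamma : nat -> R).
Hypotheses (alpha_ge1 : 1 <= alpha) (gamma1_le1 : gamma 0%N <= 1)
  (gamma_noninc : forall j, gamma j.+1 <= gamma j)
  (gamma_gt0 : forall j, 0 < gamma j).
Local Notation n := (info_complexity alpha gamma).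
Local Notation gammaI := (inf (range gamma)).

Let alpha_gt0 : 0 < alpha := lt_le_trans ltr01 alpha_ge1.

Lemma gamma_le (i j : nat) : (i <= j)%N -> gamma j <= gamma i.
Proof.
move=> /subnK <-; elim: (j - i)%N => [//|k IHk].
by rewrite addSn (le_trans (gamma_noninc _)).
Qed.

Lemma gamma_le1 (j : nat) : gamma j <= 1.
Proof. exact: le_trans (gamma_le (leq0n j)) gamma1_le1. Qed.

Lemma gammaI_le (j : nat) : gammaI <= gamma j.
Proof.
apply: ge_inf; last by exists j.
by exists 0 => _ [i _ <-]; exact: ltW.
Qed.

Lemma gammaI_ge0 : 0 <= gammaI.
Proof.
by apply: lb_le_inf; [exists (gamma 0), 0%N|move=> _ [i _ <-]; exact: ltW].
Qed.

Lemma info_complexity_ge1 (s : nat) (eps : R) : 0 < eps < 1 -> (1%:E <= n eps s)%E.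
Proof.
move=> /andP[e0 e1]; have := @info_complexity_lb_sets R alpha gamma alpha_ge1
  gamma_gt0 s eps [set finset.set0]%SET (ltW e0).
rewrite cards1; apply=> B; rewrite inE => /eqP ->.
by rewrite finset.big_set0 expr_lt1// ltW.
Qed.

(** Indices start at 0, so [gamma s] is the last and smallest weight in dimension [s.+1]. *)
Lemma info_complexity_ge_binomial (s m : nat) (eps : R) : 0 <= eps ->
  eps ^+ 2 < gamma s ^+ m -> (('C(s.+1, m))%:R%:E <= n eps s.+1)%E.
Proof.
move=> e0 em.
have -> : 'C(s.+1, m) = #|[set B : {set 'I_s.+1} | #|B| == m]%SET|.
  by rewrite card_draws card_ord.
apply: info_complexity_lb_sets => // B; rewrite inE => /eqP Bm.
apply: lt_le_trans em _; rewrite -Bm -prodr_const; apply: ler_prod => j _.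
by rewrite ltW//= gamma_le// -ltnS.
Qed.

Lemma info_complexity_ge_exp2 (s : nat) (eps : R) : (forall j, gamma j = 1) ->
  0 < eps < 1 -> ((2 ^ s)%N%:R%:E <= n eps s)%E.
Proof.
move=> g1 /andP[e0 e1].
have -> : (2 ^ s)%N = #|powerset [set: 'I_s]%SET|.
  by rewrite card_powerset cardsT card_ord.
apply: info_complexity_lb_sets => // [|B _]; first exact: ltW.
by under eq_bigr do rewrite g1; rewrite big1// expr_lt1// ltW.
Qed.

(** With eps^2 = D N^(-alpha), the first N weights in dimension 1 exceed eps^2, so N is at most a
    constant times N^(alpha tau / 2). *)
Lemma info_complexity_dim1_exponent (C tau : R) :
  (forall eps, 0 < eps < 1 -> (n eps 1 <= (C * eps `^ (- tau))%:E)%E) ->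
  2 / alpha <= tau.
Proof.
move=> H; have [c c0 Hc] := fweight_lb alpha_ge1.
have c1 : c <= 1 by have := Hc 1%N isT; rewrite powR1 mulr1 (fweight1 alpha_ge1).
(* The factor 1/2 makes eps^2 strictly smaller than the weights and keeps eps below 1. *)
pose D := gamma 0 * c / 2.
have D0 : 0 < D by rewrite !mulr_gt0.
have Dlt : D < gamma 0 * c by rewrite /D ltr_pdivrMr// ltr_pMr ?mulr_gt0// ltr1n.
have D1 : D < 1.
  by apply: lt_le_trans Dlt _; rewrite -[leRHS]mulr1 ler_pM// ltW.
suff : 1 <= alpha / 2 * tau.
  by rewrite -ler_pdivrMl ?divr_gt0// invfM invrK mulr1 mulrC.
pose K := C * Num.sqrt D `^ (- tau).
apply: (@powR_le_exponent _ _ _ K 1) => N N1; rewrite powRr1//.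
have N0 : 0 < N%:R :> R by rewrite ltr0n.
pose eps := Num.sqrt D * N%:R `^ (- (alpha / 2)).
have e0 : 0 < eps by rewrite mulr_gt0 ?sqrtr_gt0 ?powR_gt0.
have e2 : eps ^+ 2 = D * N%:R `^ (- alpha).
  rewrite exprMn sqr_sqrtr ?(ltW D0)//; congr (_ * _).
  by rewrite -powR_mulrn ?powR_ge0// -powRrM; congr (_ `^ _); field.
have Na1 : N%:R `^ (- alpha) <= 1 :> R.
  by rewrite -[leRHS](powRr0 N%:R) ler_powR ?ler1n// oppr_le0 ltW.
have e1 : eps < 1.
  rewrite -(@ltr_pXn2r _ 2)// ?nnegrE ?(ltW e0)// expr1n e2.
  by apply: le_lt_trans D1; rewrite ler_piMr// ltW.
have e01 : 0 < eps < 1 by rewrite e0.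
have lb : (N%:R%:E <= n eps 1)%E.
  apply: info_complexity_lb_dim1 => // [|k /andP[k0 kN]]; first exact: ltW.
  rewrite e2; apply: (@lt_le_trans _ _ (gamma 0 * c * N%:R `^ (- alpha))).
    by rewrite ltr_pM2r ?powR_gt0.
  rewrite -mulrA ler_pM2l//; apply: le_trans (Hc k k0); rewrite ler_pM2l//.
  rewrite !powRN lef_pV2 ?posrE ?powR_gt0 ?ltr0n//.
  by rewrite ge0_ler_powR ?nnegrE ?(ltW alpha_gt0)// ler_nat.
have := le_trans lb (H _ e01); rewrite lee_fin => /le_trans; apply.
rewrite /eps powRM ?sqrtr_ge0 ?powR_ge0// mulrA -/K -powRrM.
by rewrite le_eqVlt; apply/orP; left; apply/eqP; congr (_ * _ `^ _); ring.
Qed.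

(** * Polynomial and strong polynomial tractability *)

Lemma sum_exponent_le (D be : R) : 0 < be ->
  (forall s, gamma s <= D * s.+1%:R `^ (- be)) ->
  (sum_exponent gamma <= (be^-1)%:E)%E.
Proof.
move=> be0 HD; have D0 : 0 <= D.
  by have := HD 0%N; rewrite powR1 mulr1; apply: le_trans; exact: ltW.
apply/lee_addgt0Pr => e e0; rewrite -EFinD; set k := be^-1 + e.
have bek : be^-1 < k by rewrite ltrDl.
have k0 : 0 < k by apply: lt_trans bek; rewrite invr_gt0.
have q1 : 1 < be * k by rewrite -ltr_pdivrMl// mulr1.
apply: ereal_inf_lbound; exists k => //; split => //.
apply: (@le_lt_trans _ _ (D `^ k * (1 + (be * k - 1)^-1))%:E); last exact: ltry.
apply: lime_le; first by apply: is_cvg_nneseries => j _ _; rewrite lee_fin powR_ge0.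
apply: nearW => N; rewrite big_mkord sumEFin lee_fin.
apply: le_trans (ler_wpM2l (powR_ge0 D k) (sum_powR_le N q1)).
rewrite mulr_sumr; apply: ler_sum => i _.
rewrite -mulNr powRrM -powRM ?powR_ge0//.
by apply: ge0_ler_powR; rewrite ?nnegrE ?mulr_ge0 ?powR_ge0 ?(ltW k0) ?(ltW (gamma_gt0 _)).
Qed.

(** At eps^2 = gamma_s^m / 2 the binomial lower bound grows like s^m, so gamma_s^(m tau / 2) is at
    most a constant times s^(sigma - m). This is decay of gamma_s with exponent [be], the inverse of
    the stated bound. *)
Lemma polynomial_bound_sum_exponent (tau sigma C : R) (m : nat) :
  0 < tau -> 0 <= sigma -> 0 <= C -> sigma < m%:R ->
  (forall s eps, (0 < s)%N -> 0 < eps < 1 ->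
    (n eps s <= (C * eps `^ (- tau) * s%:R `^ sigma)%:E)%E) ->
  (sum_exponent gamma <= (m%:R * tau / (2 * (m%:R - sigma)))%:E)%E.
Proof.
move=> t0 s0 C0 sm H; have m0 : 0 < m%:R :> R := le_lt_trans s0 sm.
have ms0 : 0 < m%:R - sigma by rewrite subr_gt0.
have mt0 : 0 < m%:R * tau by rewrite mulr_gt0.
pose be := 2 * (m%:R - sigma) / (m%:R * tau).
have be0 : 0 < be by rewrite divr_gt0// mulr_gt0.
have -> : m%:R * tau / (2 * (m%:R - sigma)) = be^-1 by rewrite /be invf_div.
(* 2^m and m! come from the binomial bound, 2^(tau / 2) from the half in eps^2. *)
pose K := 2 ^+ m * (m`!%:R * (C * 2 `^ (tau / 2))).
have K0 : 0 <= K by rewrite !mulr_ge0 ?exprn_ge0 ?powR_ge0.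
apply: (@sum_exponent_le (K `^ (2 / (m%:R * tau)) + (m.*2%:R) `^ be)) => // s.
set s' : R := s.+1%:R; have s'0 : 0 < s' by [].
have [sm2|ms2] := ltnP s.+1 m.*2.
  rewrite mulrDl (@le_trans _ _ 1) ?gamma_le1//.
  rewrite (@le_trans _ _ (m.*2%:R `^ be * s' `^ (- be)))//; last first.
    by rewrite lerDr mulr_ge0 ?powR_ge0.
  rewrite powRN ler_pdivlMr ?powR_gt0// mul1r ge0_ler_powR ?nnegrE ?(ltW be0)//.
  by rewrite ler_nat ltnW.
have g0 := gamma_gt0 s.
have gm0 : 0 < gamma s ^+ m by rewrite exprn_gt0.
have gm1 : gamma s ^+ m <= 1 by rewrite exprn_ile1 ?gamma_le1// ltW.
pose eps := Num.sqrt (gamma s ^+ m / 2).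
have e0 : 0 < eps by rewrite sqrtr_gt0 divr_gt0.
have e2 : eps ^+ 2 = gamma s ^+ m / 2 by rewrite sqr_sqrtr// divr_ge0// ltW.
have elt : eps ^+ 2 < gamma s ^+ m by rewrite e2 ltr_pdivrMr// ltr_pMr// ltr1n.
have e1 : eps < 1.
  by rewrite -(@ltr_pXn2r _ 2)// ?nnegrE ?(ltW e0)// expr1n (lt_le_trans elt).
have e01 : 0 < eps < 1 by rewrite e0.
have := le_trans (info_complexity_ge_binomial (ltW e0) elt) (H s.+1 eps isT e01).
rewrite lee_fin -/s' => HC.
have eE : eps `^ (- tau) = 2 `^ (tau / 2) / gamma s `^ (m%:R * tau / 2).
  have -> : - tau = 2%:R * (- (tau / 2)) by field.
  rewrite (powRrM eps) (powR_mulrn 2 (ltW e0)) e2 powRM ?(ltW gm0)//.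
  rewrite -(powR_inv1 (ler0n R 2)) -(powRrM 2) mulN1r opprK mulrC; congr (_ * _).
  by rewrite -powR_mulrn ?(ltW g0)// -powRrM mulrN powRN mulrA.
have : gamma s `^ (m%:R * tau / 2) <= K * s' `^ (- (m%:R - sigma)).
  have := @binomial_lower_bound R _ _ ms2; rewrite -/s' expr_div_n.
  rewrite ler_pdivrMr ?exprn_gt0// => HB.
  have := ler_wpM2l (ler0n R m`!) HC; rewrite eE.
  have gp : 0 < gamma s `^ (m%:R * tau / 2) by rewrite powR_gt0.
  move=> HC'; have {HB HC'} := le_trans HB (ler_wpM2r (exprn_ge0 m (ler0n R 2)) HC').
  rewrite -powR_mulrn ?(ltW s'0)// opprB powRB; last by rewrite (gt_eqF s'0) implybT.
  set G := gamma s `^ _ in gp *; set P := s' `^ m%:R; set Q := s' `^ sigma.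
  have P0 : 0 < P by rewrite powR_gt0.
  have -> : m`!%:R * (C * (2 `^ (tau / 2) / G) * Q) * 2 ^+ m = K * Q / G.
    by rewrite /K; ring.
  by rewrite ler_pdivlMr// mulrA ler_pdivlMr// mulrC.
move=> HG; rewrite mulrDl.
apply: (@le_trans _ _ (K `^ (2 / (m%:R * tau)) * s' `^ (- be))).
  have -> : gamma s = (gamma s `^ (m%:R * tau / 2)) `^ (2 / (m%:R * tau)).
    rewrite -powRrM (_ : _ * _ = 1) ?powRr1 ?(ltW g0)//.
    by field; rewrite !gt_eqF.
  have -> : K `^ (2 / (m%:R * tau)) * s' `^ (- be) =
      (K * s' `^ (- (m%:R - sigma))) `^ (2 / (m%:R * tau)).
    rewrite powRM ?powR_ge0// -powRrM; congr (_ * _ `^ _).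
    by rewrite /be; field; rewrite !gt_eqF.
  apply: ge0_ler_powR; rewrite ?nnegrE ?powR_ge0 ?mulr_ge0 ?powR_ge0//.
  by rewrite invr_ge0 ltW.
by rewrite lerDl mulr_ge0 ?powR_ge0.
Qed.

Lemma sum_exponent_witness (t : R) : (sum_exponent gamma < t%:E)%E ->
  exists T : R, forall s, \sum_(j < s) gamma j `^ t <= T.
Proof.
move=> /ereal_inf_lt[_ [k [k0 kfin] <-]]; rewrite lte_fin => kt.
have H0 m : (0%N <= m)%N -> true -> (0 <= (gamma m `^ k)%:E)%E.
  by rewrite lee_fin powR_ge0.
have S0 : (0 <= \sum_(0 <= j <oo) (gamma j `^ k)%:E)%E by exact: nneseries_ge0.
exists (fine (\sum_(0 <= j <oo) (gamma j `^ k)%:E)%E) => s.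
apply: (@le_trans _ _ (\sum_(j < s) gamma j `^ k)).
  by apply: ler_sum => j _; rewrite ger_powR ?gamma_gt0 ?gamma_le1// ltW.
rewrite -lee_fin fineK ?ge0_fin_numE// -sumEFin.
have := @nneseries_lim_ge R (fun j => (gamma j `^ k)%:E) xpredT 0%N s H0.
by rewrite big_mkord.
Qed.

Lemma sum_exponent_ge0 : (0 <= sum_exponent gamma)%E.
Proof. by apply: le_ereal_inf_tmp => _ [k [k0 _] <-]; rewrite lee_fin ltW. Qed.

Lemma SPT_bound_of_sum_exponent (t : R) : alpha^-1 < t ->
  (sum_exponent gamma < t%:E)%E -> exists2 C, 0 < C & SPT_bound n (2 * t) C.
Proof.
move=> at_ st; have t0 : 0 < t by apply: lt_trans at_; rewrite invr_gt0.
have [S S0 HS] := fweight_powR_sum alpha_ge1 at_.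
have [T HT] := sum_exponent_witness st.
exists (expR (S * T)); first exact: expR_gt0.
move=> s eps _ /andP[e0 _].
apply: le_trans (info_complexity_ub alpha_ge1 gamma_gt0 gamma_le1 s t0 e0 HS) _.
by rewrite lee_fin mulrC ler_wpM2r ?powR_ge0// ler_expR ler_wpM2l.
Qed.

Lemma SPT_bound_ge (tau C : R) : 0 <= C -> SPT_bound n tau C ->
  2 / alpha <= tau /\ (sum_exponent gamma <= (tau / 2)%:E)%E.
Proof.
move=> C0 H; have ta : 2 / alpha <= tau.
  by apply: (@info_complexity_dim1_exponent C) => eps e01; exact: H.
split => //; have t0 : 0 < tau by apply: lt_le_trans ta; rewrite divr_gt0.
(* For sigma = 0 and m = 1 the bound is exactly tau / 2. *)
have := @polynomial_bound_sum_exponent tau 0 C 1 t0 (lexx 0) C0 ltr01.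
rewrite subr0 mulr1 mul1r; apply=> s eps s0 e01.
by rewrite powRr0 mulr1; exact: H.
Qed.

Lemma SPT_bound_PT (tau C : R) : 0 <= tau -> 0 <= C -> SPT_bound n tau C -> PT n.
Proof.
move=> t0 C0 H; exists tau, 0, C; split => // s eps s0 e01.
by rewrite powRr0 mulr1; exact: H.
Qed.

Lemma SPT_iff : SPT n <-> (sum_exponent gamma < +oo)%E.
Proof.
split=> [[tau [C [t0 C0 H]]]|soo].
  by have [_ /le_lt_trans] := SPT_bound_ge C0 H; apply; exact: ltry.
have sf : sum_exponent gamma \is a fin_num by rewrite ge0_fin_numE ?sum_exponent_ge0.
pose t := alpha^-1 + fine (sum_exponent gamma) + 1.
have f0 : 0 <= fine (sum_exponent gamma) by rewrite fine_ge0 ?sum_exponent_ge0.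
have a0 : 0 < alpha^-1 by rewrite invr_gt0.
have [||C C0 HC] := @SPT_bound_of_sum_exponent t.
- by rewrite /t; lra.
- by rewrite -[X in (X < _)%E](fineK sf) lte_fin /t; lra.
by exists (2 * t), C; split; rewrite ?(ltW C0)// /t; lra.
Qed.

(** Any integer m above sigma bounds the sum exponent; its size depends on sigma, but finiteness
    suffices for SPT. *)
Lemma PT_SPT : PT n -> SPT n.
Proof.
move=> [tau [sigma [C [t0 s0 C0 H]]]]; apply/SPT_iff.
have ta : 2 / alpha <= tau.
  apply: (@info_complexity_dim1_exponent C) => eps e01.
  by have := H 1%N eps isT e01; rewrite powR1 mulr1.
have {}t0 : 0 < tau by apply: lt_le_trans ta; rewrite divr_gt0.
have := @polynomial_bound_sum_exponent tau sigma C _ t0 s0 C0 (archi_boundP s0) H.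
by move=> /le_lt_trans; apply; exact: ltry.
Qed.

Lemma SPT_exponentE : SPT n ->
  SPT_exponent n = (2%:E * Order.max (alpha^-1)%:E (sum_exponent gamma))%E.
Proof.
move=> /SPT_iff soo.
have sf : sum_exponent gamma \is a fin_num by rewrite ge0_fin_numE ?sum_exponent_ge0.
rewrite -[in RHS](fineK sf) -EFin_max -EFinM; set m := Num.max _ _.
apply/eqP; rewrite eq_le; apply/andP; split.
  apply/lee_addgt0Pr => e e0; rewrite -EFinD.
  have -> : 2 * m + e = 2 * (m + e / 2) by field.
  have me : m < m + e / 2 by rewrite ltrDl divr_gt0.
  have t0 : 0 <= m + e / 2.
    by rewrite addr_ge0 ?divr_ge0 ?(ltW e0)// /m le_max invr_ge0 (ltW alpha_gt0).
  have [||C C0 HC] := @SPT_bound_of_sum_exponent (m + e / 2).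
  - by apply: le_lt_trans me; rewrite /m le_max lexx.
  - rewrite -[X in (X < _)%E](fineK sf) lte_fin; apply: le_lt_trans me.
    by rewrite /m le_max lexx orbT.
  apply: ereal_inf_lbound; exists (2 * (m + e / 2)) => //.
  split; first by rewrite mulr_ge0.
  by exists C.
apply: le_ereal_inf_tmp => _ [tau [t0 [C C0 H]] <-].
have [ta] := SPT_bound_ge (ltW C0) H.
rewrite -[X in (X <= _)%E](fineK sf) lee_fin => ts.
rewrite lee_fin -ler_pdivlMl// /m ge_max mulrC ts andbT.
by rewrite ler_pdivlMr// mulrC.
Qed.

(** * Quasi-polynomial tractability *)

Lemma powRN_expR (eps x : R) : 0 < eps -> eps `^ (- x) = expR (x * ln eps^-1).
Proof. by move=> e0; rewrite /powR gt_eqF// lnV ?posrE// mulNr mulrN. Qed.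

Lemma sum_ltn_le (s j0 : nat) : \sum_(j < s) (j < j0)%:R <= j0%:R :> R.
Proof.
suff H : (\sum_(j < s) (j < j0) = minn s j0)%N by rewrite -natr_sum H ler_nat geq_minr.
elim: s => [|s IHs]; first by rewrite big_ord0 min0n.
rewrite big_ord_recr/= IHs; case: ltnP => [sj|js].
  by rewrite addn1 (minn_idPl sj).
by rewrite addn0 (minn_idPr (leqW js)).
Qed.

(* As P grows like ln s, all but finitely many gamma_j^P are at most 1/s. *)
Lemma QPT_bound_of_gammaI (p : R) : alpha^-1 < p -> gammaI < expR (- p^-1) ->
  exists2 C, 0 < C & QPT_bound n (2 * p) C.
Proof.
move=> ap gp; have p0 : 0 < p by apply: lt_trans ap; rewrite invr_gt0.
have [S S0 HS] := fweight_powR_sum alpha_ge1 ap.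
have [|_ [j0 _ <-] gj0] := @inf_lt _ _ _ _ gp; first by exists (gamma 0), 0%N.
exists (expR (S * (j0%:R + 1))); first exact: expR_gt0.
move=> s eps s0 /andP[e0 e1].
have s0' : 0 < s%:R :> R by rewrite ltr0n.
have ls0 : 0 <= ln s%:R :> R by rewrite ln_ge0// ler1n.
pose P := p * (1 + ln s%:R).
have pP : p <= P by rewrite /P ler_peMr ?(ltW p0)// lerDl.
have P0 : 0 < P := lt_le_trans p0 pP.
have HP N := sum_powR_fweight_le alpha_ge1 N pP HS.
apply: le_trans (info_complexity_ub alpha_ge1 gamma_gt0 gamma_le1 s P0 e0 HP) _.
have le0 : 0 <= ln eps^-1 by rewrite ln_ge0// invf_ge1// ltW.
rewrite lee_fin mulrC; apply: ler_pM; rewrite ?expR_ge0 ?powR_ge0//; last first.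
  by rewrite powRN_expR// ler_expR /P; nra.
rewrite ler_expR ler_wpM2l//.
(* The first j0 terms are bounded by 1 each, the others by 1/s each, so the total is at most j0 + 1
   for every s. *)
apply: (@le_trans _ _ (\sum_(j < s) ((j < j0)%:R + s%:R^-1))); last first.
  rewrite big_split/= lerD ?sum_ltn_le// sumr_const card_ord -[leLHS]mulr_natr.
  by rewrite mulVf// gt_eqF.
apply: ler_sum => j _; case: ltnP => [jj0|j0j].
  apply: (@le_trans _ _ 1); last by rewrite lerDl invr_ge0 ltW.
  by rewrite -[leRHS](powRr0 (gamma j)) ger_powR ?gamma_gt0 ?gamma_le1// ltW.
(* By the choice of P this power equals exp (- (1 + ln s)), which is at most 1/s. *)
rewrite add0r; apply: (@le_trans _ _ (expR (- p^-1) `^ P)).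
  apply: ge0_ler_powR; rewrite ?nnegrE ?(ltW P0) ?(ltW (gamma_gt0 _)) ?expR_ge0//.
  exact: le_trans (gamma_le j0j) (ltW gj0).
rewrite -expRM /P mulrA mulNr mulVf ?gt_eqF// mulN1r.
rewrite -[leRHS](@lnK R) ?posrE ?invr_gt0//.
by rewrite ler_expR lnV ?posrE// lerN2 lerDr.
Qed.

(** Taking logarithms: for positive gamma_I the conclusion is equivalent to 1 / ln (1 / gamma_I) <
    p, and for gamma_I = 0 it always holds. *)
Lemma lt_expR_gammaI (p : R) : 0 < p ->
  gammaI < 1 -> (gammaI != 0 -> (ln gammaI^-1)^-1 < p) -> gammaI < expR (- p^-1).
Proof.
move=> p0 g1 H; have [->|gn0] := eqVneq gammaI 0; first exact: expR_gt0.
have g0 : 0 < gammaI by rewrite lt_neqAle eq_sym gn0 gammaI_ge0.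
have := H gn0; rewrite lnV ?posrE// => Hp.
have L0 : 0 < - ln gammaI by rewrite oppr_gt0 ln_lt0// g0.
rewrite -[X in X < _](@lnK R) ?posrE// ltr_expR ltrNr.
by rewrite invf_plt ?posrE.
Qed.

(** For s = 1 the logarithm of s vanishes and the bound reads C exp (tau) eps^(-tau). *)
Lemma QPT_bound_ge_alpha (tau C : R) : QPT_bound n tau C -> 2 / alpha <= tau.
Proof.
move=> H; apply: (@info_complexity_dim1_exponent (C * expR tau)) => eps e01.
have /andP[e0 _] := e01; have := H 1%N eps isT e01.
by rewrite ln1 addr0 mulr1 mulrDr mulr1 expRD mulrA powRN_expR.
Qed.

Lemma QPT_bound_ge_gammaI (tau C : R) : 0 < gammaI < 1 -> 0 <= tau -> 0 <= C ->
  QPT_bound n tau C -> 2 / ln gammaI^-1 <= tau.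
Proof.
move=> /andP[g0 g1] t0 C0 H.
set g := gammaI in g0 g1 *; set L := ln g^-1.
have L0 : 0 < L by rewrite ln_gt0// invf_gt1.
(* With eps^2 = g^m / 2 fixed and s tending to infinity, s^m is at most a constant times s^(tau (1 +
   ln (1/eps))). *)
have key m : m%:R <= tau * (1 + (m%:R * L + ln 2) / 2).
  have gm0 : 0 < g ^+ m by rewrite exprn_gt0.
  have gm1 : g ^+ m <= 1 by rewrite exprn_ile1// ltW.
  pose eps := Num.sqrt (g ^+ m / 2).
  have e0 : 0 < eps by rewrite sqrtr_gt0 divr_gt0.
  have e2 : eps ^+ 2 = g ^+ m / 2 by rewrite sqr_sqrtr// divr_ge0// ltW.
  have elt : eps ^+ 2 < g ^+ m by rewrite e2 ltr_pdivrMr// ltr_pMr// ltr1n.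
  have e1 : eps < 1.
    by rewrite -(@ltr_pXn2r _ 2)// ?nnegrE ?(ltW e0)// expr1n (lt_le_trans elt).
  have e01 : 0 < eps < 1 by rewrite e0.
  have lE : ln eps^-1 = (m%:R * L + ln 2) / 2.
    have := congr1 (@ln R) e2; rewrite lnXn// ln_div ?posrE// lnXn//.
    by rewrite /L !lnV ?posrE// -(mulr_natl (ln g)) mulrN; set t := _ * _; lra.
  rewrite -lE; set T := tau * _.
  apply: (@powR_le_exponent _ _ _ (2 ^+ m * (m`!%:R * (C * expR T))) (maxn 1 m.*2)).
  move=> s; rewrite geq_max => /andP[s0 ms].
  have s0' : 0 < s%:R :> R by rewrite ltr0n.
  have lb : (('C(s, m))%:R%:E <= n eps s)%E.
    case: s s0 {ms s0'} => // s _; apply: info_complexity_ge_binomial; first exact: ltW.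
    apply: lt_le_trans elt _.
    by apply: lerXn2r; rewrite ?nnegrE ?(ltW g0) ?(ltW (gamma_gt0 _)) ?gammaI_le.
  have := le_trans lb (H s eps s0 e01); rewrite lee_fin => HC.
  have := @binomial_lower_bound R _ _ ms.
  rewrite expr_div_n ler_pdivrMr ?exprn_gt0// => HB.
  rewrite powR_mulrn ?(ltW s0')//; apply: (le_trans HB).
  rewrite mulrC -!mulrA ler_pM2l ?exprn_gt0// ler_pM2l ?ltr0n ?fact_gt0//.
  apply: (le_trans HC); rewrite ler_wpM2l//.
  rewrite -[X in X `^ _](@lnK R) ?posrE// -expRM -expRD ler_expR /T; lra.
rewrite ler_pdivrMr// leNgt; apply/negP => tL.
(* If tau L < 2, then [key] says m d <= tau (1 + ln 2 / 2) for all m, which fails as soon as m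
   exceeds [B]. *)
pose d := 1 - tau * L / 2.
have d0 : 0 < d by rewrite /d; lra.
pose B := tau * (1 + ln 2 / 2) / d.
have B0 : 0 <= B.
  by rewrite divr_ge0 ?(ltW d0)// mulr_ge0// addr_ge0// divr_ge0// ln_ge0// ler1n.
have := key (Num.bound B); have := archi_boundP B0.
rewrite /B ltr_pdivrMr// /d; set x := (Num.bound _)%:R; lra.
Qed.

Lemma QPT_of_gammaI : gammaI < 1 -> QPT n.
Proof.
move=> g1; pose p := alpha^-1 + `|(ln gammaI^-1)^-1| + 1.
have a0 : 0 < alpha^-1 by rewrite invr_gt0.
have ap : alpha^-1 < p by have := normr_ge0 (ln gammaI^-1)^-1; rewrite /p; lra.
have p0 : 0 < p := lt_trans a0 ap.
have gp : gammaI < expR (- p^-1).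
  apply: lt_expR_gammaI => // _.
  by have := ler_norm (ln gammaI^-1)^-1; rewrite /p; lra.
have [C C0 HC] := QPT_bound_of_gammaI ap gp.
by exists (2 * p), C; split; rewrite ?(ltW C0)// mulr_ge0// ltW.
Qed.

Lemma QPT_exponentE : gammaI < 1 -> QPT_exponent n =
  (if gammaI != 0 then 2 * Num.max (1 / alpha) (1 / ln gammaI^-1)
   else 2 / alpha)%:E.
Proof.
move=> g1; pose m := if gammaI != 0 then Num.max (1 / alpha) (1 / ln gammaI^-1)
  else alpha^-1.
have -> : (if gammaI != 0 then 2 * Num.max (1 / alpha) (1 / ln gammaI^-1)
   else 2 / alpha) = 2 * m by rewrite /m; case: ifP.
have am : alpha^-1 <= m by rewrite /m; case: ifP => // _; rewrite le_max mul1r lexx.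
have m0 : 0 < m by apply: lt_le_trans am; rewrite invr_gt0.
apply/eqP; rewrite eq_le; apply/andP; split.
  apply/lee_addgt0Pr => e e0; rewrite -EFinD.
  have -> : 2 * m + e = 2 * (m + e / 2) by field.
  have me : m < m + e / 2 by rewrite ltrDl divr_gt0.
  have p0 : 0 < m + e / 2 := lt_trans m0 me.
  have gp : gammaI < expR (- (m + e / 2)^-1).
    apply: lt_expR_gammaI => // gn0; apply: le_lt_trans me.
    by rewrite /m gn0 le_max !mul1r lexx orbT.
  have [C C0 HC] := QPT_bound_of_gammaI (le_lt_trans am me) gp.
  apply: ereal_inf_lbound; exists (2 * (m + e / 2)) => //; split; last by exists C.
  by rewrite mulr_ge0// ltW.
apply: le_ereal_inf_tmp => _ [tau [t0 [C C0 H]] <-]; rewrite lee_fin.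
rewrite -ler_pdivlMl// /m; have ta := QPT_bound_ge_alpha H.
have ta' : alpha^-1 <= 2^-1 * tau by rewrite ler_pdivlMl.
case: ifPn => // gn0; rewrite ge_max !mul1r ta'/=.
have g0 : 0 < gammaI by rewrite lt_neqAle eq_sym gn0 gammaI_ge0.
by rewrite ler_pdivlMl//; apply: (QPT_bound_ge_gammaI _ t0 (ltW C0) H); rewrite g0.
Qed.

(** * Weak tractability *)

Lemma powRV (x y : R) : 0 <= x -> x^-1 `^ y = x `^ (- y).
Proof. by move=> x0; rewrite -(powR_inv1 x0) -powRrM mulN1r. Qed.

(** With X = s^sigma + eps^(-tau), the quotient in the definition is at most K X^(theta - 1), and X
    tends to infinity together with s + 1/eps. *)
Lemma WTst_of_le_expR (sigma tau theta K : R) : 0 < sigma -> 0 < tau ->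
  theta < 1 -> 0 <= K ->
  (forall s eps, (0 < s)%N -> 0 < eps < 1 ->
    (n eps s <= (expR (K * (s%:R `^ sigma + eps `^ (- tau)) `^ theta))%:E)%E) ->
  WTst n sigma tau.
Proof.
move=> s0 t0 th1 K0 H e e0; have d0 : 0 < 1 - theta by rewrite subr_gt0.
(* Chosen so that X >= X0 gives X^(1 - theta) > K / e, that is, K X^theta < e X. *)
pose X0 := (K / e + 1) `^ (1 - theta)^-1.
have Ke0 : 0 < K / e + 1 by rewrite ltr_wpDl// divr_ge0// ltW.
have X00 : 0 < X0 by rewrite powR_gt0.
(* Beyond this threshold, either s^sigma or eps^(-tau) alone reaches X0. *)
exists (2 * (X0 `^ sigma^-1 + X0 `^ tau^-1)) => s eps s1 e01 HM.
have /andP[ep0 ep1] := e01.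
set X := s%:R `^ sigma + eps `^ (- tau).
have cancel_ (z y : R) : 0 < z -> 0 <= y -> X0 `^ z^-1 <= y -> X0 <= y `^ z.
  move=> z0 y0 Xy; have -> : X0 = (X0 `^ z^-1) `^ z.
    by rewrite -powRrM mulVf ?gt_eqF// powRr1// ltW.
  by apply: ge0_ler_powR; rewrite ?nnegrE ?powR_ge0// ltW.
have XX0 : X0 <= X.
  have [h|h] := leP (X0 `^ sigma^-1) s%:R.
    apply: (@le_trans _ _ (s%:R `^ sigma)); first exact: cancel_.
    by rewrite lerDl powR_ge0.
  apply: (@le_trans _ _ (eps `^ (- tau))); last by rewrite lerDr powR_ge0.
  rewrite -powRV ?(ltW ep0)//.
  apply: cancel_ => //; first by rewrite invr_ge0 ltW.
  move: HM (powR_ge0 X0 tau^-1) (powR_ge0 X0 sigma^-1) h.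
  by set u := X0 `^ _; set v := X0 `^ _; set w := eps^-1; lra.
have X_gt0 : 0 < X := lt_le_trans X00 XX0.
have := info_complexity_ge1 s e01; have := H s eps s1 e01; rewrite -/X.
case: (n eps s) => [r| |] //; rewrite !lee_fin => r_le r1.
have r0 : 0 < r := lt_le_trans ltr01 r1.
rewrite lne_EFin// -EFinM abse_EFin lte_fin ger0_norm; last first.
  by rewrite mulr_ge0 ?ln_ge0// invr_ge0 ltW.
rewrite ltr_pdivrMr//.
have lr : ln r <= K * X `^ theta by rewrite -[leRHS]expRK ler_ln ?posrE ?expR_gt0.
apply: le_lt_trans lr _.
have XE : X = X `^ (1 - theta) * X `^ theta.
  rewrite -powRD; first by rewrite subrK powRr1// ltW.
  by rewrite (gt_eqF X_gt0) implybT.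
rewrite [in ltRHS]XE mulrA ltr_pM2r ?powR_gt0// -ltr_pdivrMl//.
apply: (@lt_le_trans _ _ (K / e + 1)); first by rewrite mulrC ltrDl.
have -> : K / e + 1 = X0 `^ (1 - theta).
  by rewrite /X0 -powRrM mulVf ?gt_eqF// powRr1// ltW.
by apply: ge0_ler_powR; rewrite ?nnegrE ?(ltW d0) ?(ltW X00) ?(ltW X_gt0).
Qed.

Lemma WT_scale_ge1 (sigma tau eps : R) (s : nat) : 0 < sigma -> 0 < tau ->
  (0 < s)%N -> 0 < eps < 1 ->
  [/\ 1 <= s%:R `^ sigma, 1 <= eps `^ (- tau) & (eps^-1) `^ tau = eps `^ (- tau)].
Proof.
move=> s0 t0 s1 /andP[e0 e1].
have E : eps^-1 `^ tau = eps `^ (- tau) by exact: powRV (ltW e0).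
split=> //; first by rewrite -[leLHS](powRr0 s%:R) ler_powR ?ler1n// ltW.
rewrite -E -[leLHS](powRr0 eps^-1); apply: ler_powR; last exact: ltW.
by rewrite invf_ge1// ltW.
Qed.

(** Each of the two logarithmic factors is at most a constant times X^(1/4), with X = s^sigma +
    eps^(-tau), so the exponent is of order X^(1/2). *)
Lemma QPT_UWT : QPT n -> UWT n.
Proof.
move=> [q [C [q0 C0 H]]] sigma tau /andP[s0 _] /andP[t0 _].
pose A := 1 + (sigma / 4)^-1; pose B := 1 + (tau / 4)^-1.
have A0 : 0 <= A by rewrite addr_ge0// invr_ge0 divr_ge0// ltW.
have B0 : 0 <= B by rewrite addr_ge0// invr_ge0 divr_ge0// ltW.
have lC : 0 <= ln (C + 1) by rewrite ln_ge0// lerDr.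
apply: (@WTst_of_le_expR _ _ 2^-1 (ln (C + 1) + q * (A * B))) => //.
- by rewrite invf_lt1// ltr1n.
- by rewrite addr_ge0// !mulr_ge0.
move=> s eps s1 e01; have [a1 b1 bE] := WT_scale_ge1 s0 t0 s1 e01.
have /andP[e0 e1] := e01; apply: le_trans (H s eps s1 e01) _; rewrite lee_fin.
set X := s%:R `^ _ + _; have X1 : 1 <= X by rewrite /X; lra.
have X0 : 0 < X := lt_le_trans ltr01 X1.
have C1 : 0 < C + 1 by rewrite ltr_wpDl.
apply: (@le_trans _ _ ((C + 1) * expR (q * (1 + ln s%:R) * (1 + ln eps^-1)))).
  by rewrite ler_wpM2r ?expR_ge0// lerDl.
rewrite -[X in X * _ <= _](@lnK R) ?posrE// -expRD ler_expR mulrDl.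
have h4 (y z : R) : 0 < z -> 0 <= y -> y `^ z <= X -> y `^ (z / 4) <= X `^ 4^-1.
  by move=> z0 y0 yX; rewrite powRrM; apply: ge0_ler_powR; rewrite ?nnegrE ?powR_ge0 ?(ltW X0).
have hs : 1 + ln s%:R <= A * X `^ 4^-1.
  apply: le_trans (ler1D_ln (_ : 0 < sigma / 4) _) _; rewrite ?divr_gt0 ?ler1n//.
  by rewrite ler_wpM2l// h4// lerDl powR_ge0.
have he : 1 + ln eps^-1 <= B * X `^ 4^-1.
  apply: le_trans (ler1D_ln (_ : 0 < tau / 4) _) _; rewrite ?divr_gt0 ?invf_ge1 ?(ltW e1)//.
  by rewrite ler_wpM2l// h4 ?invr_ge0 ?(ltW e0)// bE lerDr powR_ge0.
have XX : X `^ 4^-1 * X `^ 4^-1 = X `^ 2^-1.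
  rewrite -powRD; first by congr (_ `^ _); field.
  by rewrite (gt_eqF X0) implybT.
have Xh : 1 <= X `^ 2^-1 by rewrite -[leLHS](powRr0 X) ler_powR.
apply: lerD; first by rewrite ler_peMr.
rewrite -!mulrA ler_wpM2l// -XX.
have -> : A * (B * (X `^ 4^-1 * X `^ 4^-1)) = A * X `^ 4^-1 * (B * X `^ 4^-1) by ring.
have ls : 0 <= ln s%:R :> R by rewrite ln_ge0// ler1n.
have le : 0 <= ln eps^-1 by rewrite ln_ge0// invf_ge1// ltW.
by apply: ler_pM => //; rewrite addr_ge0.
Qed.

Lemma UWT_WT : UWT n -> WT n.
Proof. by apply; rewrite ltr01 lexx. Qed.

(** If gamma_I >= 1, all weights equal 1 and n is at least 2^s. At eps = 1/2 the quotient is at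
    least s ln 2 / (s + 2), which is at least ln 2 / 2 once s >= 2. *)
Lemma WT_gammaI : WT n -> gammaI < 1.
Proof.
move=> H; rewrite ltNge; apply/negP => g1.
have gj j : gamma j = 1.
  by apply/eqP; rewrite eq_le gamma_le1 (le_trans g1)// gammaI_le.
have l2 : 0 < ln 2 :> R by rewrite ln_gt0// ltr1n.
have [M HM] := H (ln 2 / 2) (divr_gt0 l2 (ltr0n R 2)).
pose s := (Num.bound `|M|).+2.
have e01 : 0 < (2^-1 : R) < 1 by rewrite invr_gt0 ltr0n invf_lt1// ltr1n.
have Ms : M <= s%:R + (2^-1)^-1.
  apply: (le_trans (ler_norm M)); apply: (le_trans (ltW (archi_boundP (normr_ge0 M)))).
  rewrite invrK -[leLHS]addr0 lerD// ler_nat /s; do 2! apply: leqW; exact: leqnn.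
have := HM s 2^-1 isT e01 Ms; have := info_complexity_ge_exp2 s gj e01.
rewrite powRr1// powRN powRr1// invrK.
have s2 : 2 <= s%:R :> R by rewrite ler_nat.
case: (n _ _) => [r| |]; [|move=> _ /=|by []]; last first.
  by rewrite gt0_mulye.
rewrite lee_fin natrX => r2.
have r0 : 0 < r by apply: lt_le_trans r2; rewrite exprn_gt0.
rewrite lne_EFin// -EFinM abse_EFin lte_fin => /(le_lt_trans (ler_norm _)).
have s20 : 0 < s%:R + 2 :> R by rewrite addr_gt0// (lt_le_trans _ s2).
rewrite ltr_pdivrMr//.
have : ln ((2 : R) ^+ s) <= ln r by rewrite ler_ln ?posrE ?exprn_gt0.
rewrite lnXn// -(mulr_natl (ln 2)).
have : ln 2 / 2 * (s%:R + 2) <= ln 2 / 2 * (s%:R * 2) :> R.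
  by rewrite ler_wpM2l ?divr_ge0 ?(ltW l2)//; lra.
set u := _ * (s%:R + 2); have -> : ln 2 / 2 * (s%:R * 2) = s%:R * ln 2 :> R by field.
lra.
Qed.

(** Since gamma_j <= 1, ln n is at most 2 p ln (1/eps) + S s for a fixed p. The linear term is
    (s^sigma)^(1/sigma) with 1/sigma < 1, and the logarithm is absorbed by the square root of
    eps^(-tau); [theta] is the larger of the two exponents. *)
Lemma WTst_sigma_gt1 (sigma tau : R) : 1 < sigma -> 0 < tau -> WTst n sigma tau.
Proof.
move=> s1 t0; have s0 : 0 < sigma := lt_trans ltr01 s1.
pose p := alpha^-1 + 1.
have ap : alpha^-1 < p by rewrite ltrDl.
have p0 : 0 < p by apply: lt_trans ap; rewrite invr_gt0.
have [S S0 HS] := fweight_powR_sum alpha_ge1 ap.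
pose theta := Num.max sigma^-1 2^-1; pose B := 1 + (tau / 2)^-1.
have B0 : 0 <= B by rewrite addr_ge0// invr_ge0 divr_ge0// ltW.
apply: (@WTst_of_le_expR _ _ theta (2 * p * B + S)) => //.
- by rewrite gt_max !invf_lt1// s1 ltr1n.
- by rewrite addr_ge0// !mulr_ge0// ltW.
move=> s eps s_gt0 e01; have [a1 b1 bE] := WT_scale_ge1 s0 t0 s_gt0 e01.
have /andP[e0 e1] := e01.
apply: le_trans (info_complexity_ub alpha_ge1 gamma_gt0 gamma_le1 s p0 e0 HS) _.
rewrite lee_fin powRN_expR// -expRD ler_expR [leRHS]mulrDl.
set X := s%:R `^ _ + _; have X1 : 1 <= X by rewrite /X; lra.
have X0 : 0 < X := lt_le_trans ltr01 X1.
have h (y z q : R) : 0 <= q -> 0 <= y -> q <= theta -> y `^ z <= X ->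
    y `^ (z * q) <= X `^ theta.
  move=> q0 y0 qt yX; apply: (@le_trans _ _ (X `^ q)); last exact: ler_powR.
  by rewrite powRrM; apply: ge0_ler_powR; rewrite ?nnegrE ?powR_ge0 ?(ltW X0).
apply: lerD; last rewrite ler_wpM2l//.
  rewrite -[leRHS]mulrA; apply: ler_wpM2l; first by rewrite mulr_ge0// ltW.
  have le : 1 <= eps^-1 by rewrite invf_ge1// ltW.
  apply: (@le_trans _ _ (1 + ln eps^-1)); first by rewrite lerDr.
  apply: le_trans (ler1D_ln (_ : 0 < tau / 2) le) _; first by rewrite divr_gt0.
  rewrite ler_wpM2l// h ?invr_ge0 ?(ltW e0)//.
    by rewrite /theta le_max lexx orbT.
  by rewrite bE lerDr powR_ge0.
apply: (@le_trans _ _ s%:R).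
  apply: (@le_trans _ _ (\sum_(j < s) 1)); last by rewrite sumr_const card_ord.
  apply: ler_sum => j _.
  by rewrite -[leRHS](powRr0 (gamma j)) ger_powR ?gamma_gt0 ?gamma_le1// ltW.
have -> : s%:R = s%:R `^ (sigma * sigma^-1) :> R by rewrite divff ?gt_eqF// powRr1.
apply: h => //; first by rewrite invr_ge0 ltW.
  by rewrite /theta le_max lexx.
by rewrite lerDl powR_ge0.
Qed.

End tractability.

Theorem theorem16 (R : realType) (alpha : R) (gamma : nat -> R)
    (alpha_ge1 : 1 <= alpha)
    (gamma1_le1 : gamma 0%N <= 1)
    (gamma_noninc : forall j, gamma j.+1 <= gamma j)
    (gamma_gt0 : forall j, 0 < gamma j) :
  let n := info_complexity alpha gamma in
  let gammaI := inf (range gamma) in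
  let s_gamma := sum_exponent gamma in
  [/\ (SPT n <-> (s_gamma < +oo)%E) /\
        (SPT n ->
          SPT_exponent n = (2%:E * Order.max (alpha^-1)%:E s_gamma)%E),
      SPT n <-> PT n,
      [/\ QPT n <-> UWT n, UWT n <-> WT n, WT n <-> gammaI < 1 &
        gammaI < 1 ->
          QPT_exponent n =
            (if gammaI != 0
             then 2 * Num.max (1 / alpha) (1 / ln gammaI^-1)
             else 2 / alpha)%:E] &
      forall sigma tau : R, 1 < sigma -> 0 < tau -> WTst n sigma tau].
Proof.
move=> n gammaI s_gamma.
(* The four conditions are closed into a cycle, from which the stated equivalences follow. *)
have Q_U : QPT n -> UWT n by exact: QPT_UWT.
have U_W : UWT n -> WT n by exact: UWT_WT.
have W_g : WT n -> gammaI < 1 by exact: WT_gammaI.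
have g_Q : gammaI < 1 -> QPT n by exact: QPT_of_gammaI.
split.
- by split; [exact: SPT_iff|exact: SPT_exponentE].
- split; last exact: PT_SPT.
  by move=> [tau [C [t0 C0 H]]]; exact: SPT_bound_PT H.
- split; [by split; auto|by split; auto|by split; auto|exact: QPT_exponentE].
- by move=> sigma tau; exact: WTst_sigma_gt1.
Qed.
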